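(* Consider the general (non-i.i.d.) change-point model with prior $(\pi_k)_{k\ge1}$. Suppose that for some $0<q<\infty$ and some $r\ge 1$ the following conditions hold: (a) for all $\varepsilon>0$ and all $k\ge 1$, $$P_k\left\{\frac1M\max_{1\le n\le M}Z_{k+n-1}^k\ge(1+\varepsilon)q\right\}\to 0\quad\text{as } M\to\infty;$$ (b) for all $\varepsilon>0$, $\sum_{k=1}^\infty\pi_kE_k(T_{k,\varepsilon})^r<\infty$, where $$T_{k,\varepsilon}=\sup\{n\ge 1: n^{-1}Z_{k+n-1}^k-q<-\varepsilon\}\qquad(\sup\varnothing=0);$$ (c) $\sum_{k=1}^\infty|\log\pi_k|^m\pi_k<\infty$ for $0<m\le r$. Then for all $0<m\le r$ $$D_m^\pi(\tau_A)\sim\left(\frac{\log A}{q}\right)^m\quad\text{as } A\to\infty .$$ If $A=A_\alpha=1/\alpha$, then $\tau_{A_\alpha}\in\Delta_\infty(\alpha)$ and for all $0<m\le r$ $$\inf_{\tau\in\Delta_\infty(\alpha)}D_m^\pi(\tau)\sim D_m^\pi(\tau_{A_\alpha})\sim\left(\frac{|\log\alpha|}{q}\right)^m\quad\text{as }\alpha\to0 .$$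
   Context: General change-point model: observations $X_1,X_2,\dots$, $\mathbf X_1^{n}=(X_1,\dots,X_n)$, $\mathcal F_n=\sigma(\mathbf X_1^n)$ ($\mathcal F_0$ trivial). $f_0(X_i\mid\mathbf X_1^{i-1})$ and $f_1(X_i\mid\mathbf X_1^{i-1})$ are (pre- and post-change) conditional probability densities of $X_i$ given $\mathbf X_1^{i-1}$; they may depend on $i$, and $f_1$ may also depend on the change point $k$. For $1\le k<\infty$, $P_k$ (expectation $E_k$) is the law under which the conditional density of $X_i$ is $f_0(X_i\mid\mathbf X_1^{i-1})$ for $i<k$ and $f_1(X_i\mid\mathbf X_1^{i-1})$ for $i\ge k$ (change point $\lambda=k$). $P_\infty$ is the law under which it is $f_0(X_i\mid\mathbf X_1^{i-1})$ for all $i$. It is assumed that on each $\mathcal F_n$ the measure $P_k$ is absolutely continuous with respect to $P_\infty$, with density the likelihood ratio $e^{Z_n^k}$ for $k\le n$, where $$Z_n^k=\sum_{i=k}^n\log\frac{f_1(X_i\mid\mathbf X_1^{i-1})}{f_0(X_i\mid\mathbf X_1^{i-1})},\quad k\le n$$ (with $f_1$ the post-change density for change point $k$). Prior: $\pi_k=P(\lambda=k)$, $k\ge1$, $\pi_k\ge0$, $\sum_{k\ge1}\pi_k=1$ (no mass at $0$); convention $0\cdot|\log0|^m=0$. $P^\pi$ (expectation $E^\pi$) is the joint law of $\lambda$ and the observations: $P^\pi(\lambda=k,B)=\pi_kP_k(B)$. Detection procedures: stopping times $\tau$ with respect to $(\mathcal F_n)_{n\ge 0}$, possibly infinite. For $0<\alpha<1$,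 $\Delta_\infty(\alpha)=\{\tau:P_\infty(\tau<\infty)\le\alpha\}$. For $m>0$, $D_m^\pi(\tau)=E^\pi[(\tau-\lambda)^m\mid\tau\ge\lambda]$. Procedure $\tau_A$: $G_n=\sum_{k=1}^n\pi_ke^{Z_n^k}+\Pi_{n+1}$ with $\Pi_{n+1}=\sum_{j\ge n+1}\pi_j$, and for $A>1$, $\tau_A=\min\{n\ge1:G_n\ge A\}$ ($\min\varnothing=\infty$). $a\sim b$ means $a/b\to1$. *)

(* Defs.v *)
(* MathComp + MathComp-Analysis *)
From HB Require Import structures.
From mathcomp Require Import all_boot all_order all_algebra.
From mathcomp Require Import all_classical all_reals all_analysis.
Set Implicit Arguments.
Unset Strict Implicit.
Unset Printing Implicit Defensive.
Import Order.TTheory GRing.Theory Num.Theory.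
Import numFieldNormedType.Exports.
Local Open Scope classical_set_scope.
Local Open Scope ring_scope.
Local Open Scope ereal_scope.

(* Time is 1-based throughout: the observations are X 1, X 2, ..., the change
   point ranges over k >= 1, and the values at index 0 of X, P, pi and of the
   conditional densities are never used. *)

Section observations.
Context {d e : measure_display} {T : measurableType d} {E : measurableType e}.
Variable X : nat -> T -> E.

(* (X 1, ..., X n) *)
Definition history (n : nat) (w : T) : n.-tuple E := [tuple X j.+1 w | j < n].

(* sigma(X 1, ..., X n) *)
Definition obs_sigma (n : nat) : set (set T) :=
  <<s \bigcup_(i in [set i | (1 <= i <= n)%N])
        preimage_set_system setT (X i) measurable >>.

End observations.

Section densities.
Context {R : realType} {d e : measure_display}
  {T : measurableType d} {E : measurableType e}.
Variables (mu : {measure set E -> \bar R}) (X : nat -> T -> E).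

Record transition_density (n : nat) (f : n.-tuple E -> E -> R) : Prop := {
  density_measurable :
    measurable_fun setT (fun p : n.-tuple E * E => f p.1 p.2);
  density_ge0 : forall h x, (0 <= f h x)%R;
  density_int1 : forall h, \int[mu]_x (f h x)%:E = 1
}.

(* Under Q, f is the conditional density (w.r.t. mu) of X i given
   X 1, ..., X (i - 1). *)
Definition conditional_density (Q : probability T R) (i : nat)
    (f : i.-1.-tuple E -> E -> R) : Prop :=
  transition_density f /\
  forall B C, obs_sigma X i.-1 B -> measurable C ->
    Q (B `&` X i @^-1` C) =
    \int[Q]_(w in B) \int[mu]_(x in C) (f (history X i.-1 w) x)%:E.

(* f1 k i is the post-change conditional density of X i when the change point
   is k. *)
Variables (f0 : forall i : nat, i.-1.-tuple E -> E -> R)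
  (f1 : forall k i : nat, i.-1.-tuple E -> E -> R).
Arguments f0 i _ _ : clear implicits.
Arguments f1 k i _ _ : clear implicits.

(* Z k n is Z_n^k. It is extended-real valued because f1 may vanish (log 0 is
   -oo); the value chosen where f0 vanishes is irrelevant, since f0 (X i | ...)
   is nonzero almost surely under the pre-change law, hence also under every
   P k. *)
Definition llr (k n : nat) (w : T) : \bar R :=
  \sum_(k <= i < n.+1)
    lne (f1 k i (history X i.-1 w) (X i w) /
         f0 i (history X i.-1 w) (X i w))%:E.

Record changepoint_model (Pinf : probability T R) (P : nat -> probability T R)
  : Prop := {
  obs_measurable : forall i, (1 <= i)%N -> measurable_fun setT (X i);
  prechange_law : forall i, (1 <= i)%N -> conditional_density Pinf (f0 i);
  before_change : forall k i, (1 <= i)%N -> (i < k)%N ->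
    conditional_density (P k) (f0 i);
  after_change : forall k i, (1 <= k)%N -> (k <= i)%N ->
    conditional_density (P k) (f1 k i);
  likelihood_ratio : forall k n, (1 <= k)%N -> (k <= n)%N ->
    forall B, obs_sigma X n B -> P k B = \int[Pinf]_(w in B) expeR (llr k n w)
}.

End densities.

Section prior.
Context {R : realType} {d : measure_display} {T : measurableType d}.

Record is_prior (pi : nat -> R) : Prop := {
  prior_ge0 : forall k, (1 <= k)%N -> (0 <= pi k)%R;
  prior_sum1 : \sum_(1 <= k <oo) (pi k)%:E = 1
}.

(* Ppi, a law of the pair (lambda, w), is characterised by
   Ppi (lambda = k, B) = pi_k P_k (B); it gives mass 0 to lambda = 0 because
   the masses over k >= 1 already add up to 1. *)
Definition is_joint_law (pi : nat -> R) (P : nat -> probability T R)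
    (Ppi : probability (nat * T)%type R) : Prop :=
  forall k B, (1 <= k)%N -> measurable B ->
    Ppi ([set k] `*` B) = (pi k)%:E * P k B.

End prior.

Section detection.
Context {R : realType} {d e : measure_display}
  {T : measurableType d} {E : measurableType e}.
Variable X : nat -> T -> E.

(* A random time is a map T -> option nat, None standing for infinity. *)
Definition ext_time (t : option nat) : \bar R :=
  if t is Some n then n%:R%:E else +oo.

Definition stopping_time (tau : T -> option nat) : Prop :=
  forall n, obs_sigma X n [set w | exists2 j, tau w = Some j & (j <= n)%N].

Definition Delta_inf (Pinf : probability T R) (alpha : R)
    : set (T -> option nat) :=
  [set tau | stopping_time tau /\
             Pinf [set w | exists j, tau w = Some j] <= alpha%:E].

Definition cond_expectation {d' : measure_display} {S : measurableType d'}
    (Q : probability S R) (Y : S -> \bar R) (B : set S) : \bar R :=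
  (\int[Q]_(z in B) Y z) / Q B.

(* D_m^pi(tau); the pair z is (lambda, w). *)
Definition delay_moment (Ppi : probability (nat * T)%type R) (m : R)
    (tau : T -> option nat) : \bar R :=
  cond_expectation Ppi
    (fun z => (ext_time (tau z.2) - z.1%:R%:E) `^ m)
    [set z | z.1%:R%:E <= ext_time (tau z.2)].

Definition first_time (p : pred nat) : option nat :=
  match pselect (exists n, p n) with
  | left h => Some (ex_minn h)
  | right _ => None
  end.

Variables (pi : nat -> R) (Z : nat -> nat -> T -> \bar R).

Definition Gstat (n : nat) (w : T) : \bar R :=
  \sum_(1 <= k < n.+1) (pi k)%:E * expeR (Z k n w)
  + \sum_(n.+1 <= j <oo) (pi j)%:E.

Definition tauA (A : R) (w : T) : option nat :=
  first_time [pred n | (1 <= n)%N && (A%:E <= Gstat n w)].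

(* T_{k,eps}; adding 0 to the set realises the convention sup(empty) = 0 and
   does not alter the supremum otherwise. *)
Definition last_entry (q eps : R) (k : nat) (w : T) : \bar R :=
  ereal_sup ([set 0] `|`
    [set n%:R%:E | n in [set n : nat | (1 <= n)%N /\
       (n%:R^-1)%:E * Z k (k + n - 1)%N w - q%:E < (- eps)%:E]]).

End detection.

Definition asymp_equiv {R : realType} {I : Type} (F : set_system I)
    (a b : I -> \bar R) : Prop :=
  (fun x => a x / b x) x @[x --> F] --> (1 : \bar R).

(* Main.v *)
(* Lower bound.  On F_(k+N-1) the law P_k has density exp(Z^k) with respect to
   Pinf, so for tau in Delta_inf(alpha) the event {tau < k + N} has P_k-mass at
   most alpha * exp((1 + eps) q N) + P_k (Z^k_(k+N-1) >= (1 + eps) q N).  With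
   N = (1 - eps) |ln alpha| / q both terms vanish after averaging over the
   prior, so with probability close to 1 the delay is at least N.

   Upper bound.  G_n >= pi_k exp(Z_n^k), and Z_n^k >= (q - eps) (n - k + 1)
   beyond the last entry time T_(k,eps), hence
     tau_A - k <= T_(k,eps) + (ln A + |ln pi_k|) / (q - eps);
   the moments of T_(k,eps) and |ln pi_k| only contribute O(1).

   False alarms.  A Pinf (tau_A = n) <= E_inf [G_n; tau_A = n]
   = P^pi (tau_A = n), because P_k and Pinf agree on F_(k-1); sum over n. *)
Require Import Defs.
From HB Require Import structures.
From mathcomp Require Import all_boot all_order all_algebra.
From mathcomp Require Import all_classical all_reals all_analysis.
From mathcomp Require Import measurable_realfun.
From mathcomp Require Import ring lra.
Set Implicit Arguments.
Unset Strict Implicit.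
Unset Printing Implicit Defensive.
Import Order.TTheory GRing.Theory Num.Theory.
Import numFieldNormedType.Exports.
Local Open Scope classical_set_scope.
Local Open Scope ring_scope.
Local Open Scope ereal_scope.

(** Condition (a) is assumed for each change point separately, with no uniformity in k, while the
    infimum over [Delta_inf] calls for one threshold serving all procedures. Hence [A] is fixed
    before [tau] in the lower bound, and the average over the prior is a dominated-convergence
    argument under [Ppi]. The delay moment is a quotient. Its lower bound uses only that the
    denominator is at most 1; its upper bound needs a denominator close to 1, which the lower-bound
    argument also supplies, because a delay of at least N excludes a false alarm. Since m may lie
    below 1, Minkowski's inequality is replaced by a splitting inequality whose leading coefficient
    can be brought arbitrarily close to 1. The likelihood ratio is given only for k <= n, so the
    agreement of P_k and Pinf before the change is recovered from the conditional densities.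
    Equivalences are proved as bounds by factors 1 - eta and 1 + eta, which also yield finiteness of
    the extended-valued moments; they are obtained for A tending to infinity and carried over to
    alpha = 1/A. *)

Section filtration.
Context {R : realType} {d e : measure_display}
  {T : measurableType d} {E : measurableType e} {X : nat -> T -> E}.
Hypothesis mX : forall i, (1 <= i)%N -> measurable_fun setT (X i).

(** * The observation filtration and measurability with respect to it *)

Definition obs_events (n : nat) : set (set T) :=
  \bigcup_(i in [set i | (1 <= i <= n)%N])
    preimage_set_system setT (X i) measurable.

(* T carrying only F_n, so that F_n-measurability is measurability on this type. *)
Definition filtered (n : nat) := g_sigma_algebraType (obs_events n).

HB.instance Definition _ n := Measurable.on (filtered n).

Lemma obs_sigma_measurable n (B : set T) : obs_sigma X n B -> measurable B.
Proof.
apply: smallest_sub; first exact: sigma_algebra_measurable.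
move=> _ [i /= /andP[i1 _] [C mC <-]]; exact: mX.
Qed.

Lemma measurable_filtered_id n :
  measurable_fun [set: T] (id : T -> filtered n).
Proof. by move=> _ B mB; rewrite setTI; exact: obs_sigma_measurable mB. Qed.

Lemma measurable_filtered {d' : measure_display} {Y : measurableType d'} n
    (f : T -> Y) :
  measurable_fun [set: filtered n] f -> measurable_fun [set: T] f.
Proof. by move=> mf; apply: (measurableT_comp mf (measurable_filtered_id (n := n))). Qed.

Lemma measurable_obs n i : (1 <= i <= n)%N ->
  measurable_fun [set: filtered n] (X i).
Proof. by move=> in1 _ C mC; apply: sub_sigma_algebra; exists i => //; exists C. Qed.

Lemma obs_sigma_mono n p (B : set T) :
  (n <= p)%N -> obs_sigma X n B -> obs_sigma X p B.
Proof.
move=> np; apply: sub_sigma_algebra2 => C [i /= /andP[i1 i_n] iC].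
by exists i => //=; rewrite i1 (leq_trans i_n).
Qed.

Lemma measurable_history n p : (n <= p)%N ->
  measurable_fun [set: filtered p] (history X n).
Proof.
move=> np; apply/measurable_fun_tnthP => i.
rewrite (_ : _ \o _ = X i.+1); last by apply/funext => w /=; rewrite tnth_mktuple.
by apply: measurable_obs => /=; rewrite (leq_trans _ np).
Qed.

End filtration.
Arguments filtered {d e T E} X n.

Lemma measurable_expeR {R : realType} :
  measurable_fun [set: \bar R] (@expeR R).
Proof.
rewrite (_ : expeR (R:=R) = fun x => if x \is a fin_num then (expR (fine x))%:E
    else if x == +oo then +oo else 0); last by apply/funext; case.
apply: measurable_fun_ifT => //=.
- apply: (measurable_fun_bool true).
  rewrite setTI (_ : _ @^-1` _ = EFin @` setT).
    by apply: measurable_image_EFin; exact: measurableT.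
  apply/seteqP; split => [x finx|x [s sx <-//]]/=.
  by exists (fine x) => //; rewrite fineK.
- by apply/measurable_EFinP; exact: (@measurableT_comp _ _ _ _ _ _ expR).
- by apply: measurable_fun_ifT => //=; exact: measurable_fun_eqe.
Qed.

Lemma measurable_lne_EFin {R : realType} :
  measurable_fun [set: R] (fun x : R => lne x%:E).
Proof.
rewrite (_ : (fun _ => _) = fun x : R => if (x <= 0)%R then -oo else (ln x)%:E);
  last by apply/funext => x; rewrite /lne.
apply: measurable_fun_ifT => //=; first exact: measurable_fun_ler.
by apply/measurable_EFinP.
Qed.


(** An F_n-measurable integrand sees a measure only through its restriction to F_n, and that
    restriction is the pushforward along the identity map into [filtered X n]. *)
Lemma eq_integral_filtered {R : realType} {d e : measure_display}
    {T : measurableType d} {E : measurableType e} (X : nat -> T -> E)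
    (m1 m2 : {measure set T -> \bar R}) n (B : set T) (h : T -> \bar R) :
  (forall i, (1 <= i)%N -> measurable_fun setT (X i)) ->
  (forall A, obs_sigma X n A -> m1 A = m2 A) ->
  obs_sigma X n B -> measurable_fun [set: filtered X n] h ->
  (forall w, 0 <= h w) ->
  \int[m1]_(w in B) h w = \int[m2]_(w in B) h w.
Proof.
move=> mX m12 nB mh h0.
have mid := measurable_filtered_id mX (n := n).
have mB : measurable (B : set (filtered X n)) by [].
have mhB : measurable_fun (B : set (filtered X n)) h by exact: measurable_funTS.
have E1 m := @ge0_integral_pushforward _ _ _ _ _ _ mid m _ _ mB mhB (fun w _ => h0 w).
rewrite -[LHS]E1 -[RHS]E1.
by apply: eq_measure_integral => A mA _; exact: m12.
Qed.

(** * Log-likelihood ratios, and agreement of the laws before the change *)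

Section model.
Context {R : realType} {d e : measure_display}
  {T : measurableType d} {E : measurableType e}
  {mu : {sigma_finite_measure set E -> \bar R}}
  {X : nat -> T -> E}
  {f0 : forall i : nat, i.-1.-tuple E -> E -> R}
  {f1 : forall k i : nat, i.-1.-tuple E -> E -> R}
  {Pinf : probability T R} {P : nat -> probability T R}.
Hypothesis model : changepoint_model mu X f0 f1 Pinf P.
Let mX := obs_measurable model.
Let Z := llr X f0 f1.

Lemma measurable_density_obs i p (f : i.-1.-tuple E -> E -> R) :
  (1 <= i <= p)%N -> transition_density mu f ->
  measurable_fun [set: filtered X p] (fun w => f (history X i.-1 w) (X i w)).
Proof.
move=> /andP[i1 ip] [mf _ _].
apply: (measurableT_comp mf (g := fun w : filtered X p => (history X i.-1 w, X i w))).
apply: measurable_fun_pair.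
- by apply: measurable_history; rewrite (leq_trans (leq_pred _)).
- by apply: measurable_obs; rewrite i1.
Qed.

Lemma measurable_llr k n p : (1 <= k)%N -> (n <= p)%N ->
  measurable_fun [set: filtered X p] (Z k n).
Proof.
move=> k1 np; rewrite /Z /llr.
(* Terms outside the range become 0, so that measurability is asked only at indices where the model
   supplies both densities. *)
under eq_fun do rewrite big_nat_cond big_mkcond/=.
apply: emeasurable_sum => i.
have [|_] := boolP ((k <= i < n.+1)%N && true); last by [].
rewrite andbT ltnS => /andP[ki i_n].
have ip : (1 <= i <= p)%N by rewrite (leq_trans k1 ki) (leq_trans i_n np).
have [td0 _] := prechange_law model (leq_trans k1 ki).
have [td1 _] := after_change model k1 ki.
apply: (measurableT_comp measurable_lne_EFin).
apply: measurable_funM; first exact: measurable_density_obs td1.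
under eq_fun do rewrite -powR_inv1 ?(density_ge0 td0)//.
apply: (measurableT_comp (measurable_powR _)); exact: measurable_density_obs td0.
Qed.


(** Induction on n. The sets B [&] {X_(n+1) in C} with B in F_n form a pi-system generating F_(n+1),
    and on such a set both laws integrate the same kernel, given by [f0], against restrictions to
    F_n that are equal by induction. *)
Lemma prechange_agree k n B : (n < k)%N -> obs_sigma X n B -> P k B = Pinf B.
Proof.
elim: n B => [|n IH] B nk nB.
  (* F_0 has no generators; the pi-system made of the whole space alone suffices, both laws having
     mass 1. *)
  apply: (@g_sigma_algebra_measure_unique _ _ _ [set setT] _ (fun=> setT) _ _ (P k) Pinf) => //.
  - by move=> _ ->; exact: measurableT.
  - by rewrite bigcup_const//; exists 0%N.
  - by move=> _ _ -> ->; rewrite setIT.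
  - move=> _ ->; exact: etrans (probability_setT _) (esym (probability_setT _)).
  - by move=> ?; rewrite [X in X < _]probability_setT ltry.
  - apply: sub_sigma_algebra2 nB => A [i /= /andP[i1]].
    by rewrite leqn0 => /eqP i0; rewrite i0 in i1.
have [td cdk] := before_change model (ltn0Sn n) nk.
have [_ cdi] := prechange_law model (ltn0Sn n).
pose G : set (set T) := [set A | exists B C, [/\ obs_sigma X n B, measurable C &
  A = B `&` X n.+1 @^-1` C]].
have nT : obs_sigma X n setT by exact: (@measurableT _ (filtered X n)).
apply: (@g_sigma_algebra_measure_unique _ _ _ G _ (fun=> setT) _ _ (P k) Pinf) => //.
- move=> _ [A [C [nA mC ->]]]; apply: measurableI.
    exact: obs_sigma_measurable nA.
  by rewrite -[X in measurable X]setTI; exact: mX.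
- by move=> _; exists setT, setT; split => //; rewrite preimage_setT setIT.
- by rewrite bigcup_const//; exists 0%N.
- move=> _ _ [A [C [nA mC ->]]] [A' [C' [nA' mC' ->]]].
  exists (A `&` A'), (C `&` C'); split.
  + exact: (@measurableI _ (filtered X n)).
  + exact: measurableI.
  + by rewrite preimage_setI setIACA.
- move=> _ [A [C [nA mC ->]]].
  rewrite [LHS]cdk// [RHS]cdi//.
  apply: (@eq_integral_filtered _ _ _ _ _ X _ _ n) => //.
  + by move=> A' nA'; apply: IH => //; exact: ltnW.
  (* The inner integral is a section integral evaluated at the history, so Tonelli for the
     sigma-finite [mu] makes it F_n-measurable. *)
  + pose g := (fun p : n.-tuple E * E => (@f0 n.+1 p.1 p.2)%:E) \_ (setT `*` C).
    rewrite (_ : (fun w => _) = fubini_F mu g \o history X n); last first.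
      apply/funext => w /=; rewrite /fubini_F [LHS]integral_mkcond.
      apply: eq_integral => x _; rewrite /g !patchE.
      by congr (if _ then _ else _); apply/idP/idP; rewrite !inE => //= -[].
    apply: measurableT_comp; last exact: measurable_history.
    apply: measurable_fun_fubini_tonelli_F.
    * apply/(measurable_restrictT _ _).1; first exact: measurableX.
      apply: measurable_funTS; apply/measurable_EFinP.
      exact: density_measurable td.
    * by move=> p; rewrite /g patchE; case: ifPn => // _; rewrite lee_fin (density_ge0 td).
  + by move=> w; apply: integral_ge0 => x _; rewrite lee_fin (density_ge0 td).
- by move=> ?; rewrite [X in X < _]probability_setT ltry.
- apply: sub_sigma_algebra2 nB => _ [i /= /andP[i1 i_n] [C mC <-]].
  have [->|ni] := eqVneq i n.+1.
    by exists setT, C.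
  exists (X i @^-1` C), setT; split => //.
    apply: sub_sigma_algebra; exists i => /=.
      by rewrite i1 -ltnS ltn_neqAle ni.
    by exists C => //; rewrite setTI.
  by rewrite preimage_setT setTI setIT.
Qed.
End model.

(** * Disintegration of the joint law over the change point *)

Lemma nneseries_shift {R : realType} (u : nat -> \bar R) n :
  (forall k, (n <= k)%N -> 0 <= u k) ->
  \sum_(n <= k <oo) u k = \sum_(k <oo) u (n + k)%N.
Proof.
(* The sign of [u] is unknown below n; [v] is nonnegative everywhere and has the same tail. *)
move=> u0; pose v k := if (k < n)%N then 0 else u k.
transitivity (\sum_(n <= k <oo) v k).
  congr (limn _); apply/funext => j; apply: eq_big_nat => k /andP[nk _].
  by rewrite /v ltnNge nk.
rewrite -nneseries_addn; last by move=> k; rewrite /v; case: ltnP => // /u0.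
by apply: eq_eseriesr => i _; rewrite /v addnC ltnNge leq_addr.
Qed.

Lemma nneseries_shift1 {R : realType} (u : nat -> \bar R) :
  (forall k, (1 <= k)%N -> 0 <= u k) ->
  \sum_(1 <= k <oo) u k = \sum_(k <oo) u k.+1.
Proof. exact: nneseries_shift. Qed.

Lemma measurable_nat_prod {d d' : measure_display} {T : measurableType d}
    {Y : measurableType d'} (f : nat * T -> Y) :
  (forall k, measurable_fun [set: T] (fun w => f (k, w))) ->
  measurable_fun [set: nat * T] f.
Proof.
move=> mf _ B mB; rewrite setTI.
rewrite (_ : _ @^-1` _ = \bigcup_k ([set k] `*` ((fun w => f (k, w)) @^-1` B))).
  apply: bigcupT_measurable => k; apply: measurableX => //.
  by rewrite -[X in measurable X]setTI; exact: mf.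
apply/seteqP; split => [[k w] /= Bkw|[k w] [_ _ [/= -> //]]].
by exists k.
Qed.

Section joint_law.
Context {R : realType} {d : measure_display} {T : measurableType d}
  {P : nat -> probability T R} { pi : nat -> R}
  {Ppi : probability (nat * T)%type R}.
Hypotheses (prior : is_prior pi) (joint : is_joint_law pi P Ppi).

Let pi0 k : 0 <= (pi k.+1)%:E.
Proof. by rewrite lee_fin (prior_ge0 prior). Qed.

Let slice (B : set (nat * T)) k := [set w | B (k, w)].

Let measurable_slice B k : measurable B -> measurable (slice B k).
Proof.
move=> mB; rewrite -[slice B k]setTI.
exact: (measurableT_comp (@measurable_id _ _ setT) (measurable_pair1 _)).
Qed.

Let joint_slices B : measurable B ->
  Ppi B = \sum_(k <oo) Ppi ([set k] `*` slice B k).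
Proof.
move=> mB; rewrite -measure_semi_bigcup.
- congr (Ppi _); apply/seteqP; split => [[k w] Bkw|[k w] [_ _ [/= -> //]]].
  by exists k.
- by move=> k; apply: measurableX => //; exact: measurable_slice.
- by move=> i j _ _ [[k w] [[/= <- _] [/= <- _]]].
- apply: bigcupT_measurable => k; apply: measurableX => //.
  exact: measurable_slice.
Qed.

Let joint0 B : measurable B -> Ppi ([set 0%N] `*` B) = 0.
Proof.
move=> mB; apply/eqP; rewrite eq_le measure_ge0 andbT.
apply: (@le_trans _ _ (Ppi ([set 0%N] `*` [set: T]))).
  apply: le_measure; rewrite ?inE; [exact: measurableX|exact: measurableX|].
  by move=> [k w] [].
have := probability_setT Ppi; rewrite joint_slices//.
rewrite nneseries_recl//.
rewrite [X in _ + X](_ : _ = 1); last first.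
  rewrite -(prior_sum1 prior) nneseries_shift1// nneseries_shift1//.
    apply: eq_eseriesr => k _.
    rewrite [LHS]joint//; last exact: measurable_slice.
    by rewrite -/(slice setT k.+1) [X in _ * X](probability_setT (P k.+1)) mule1.
  by move=> k k1; rewrite lee_fin (prior_ge0 prior).
rewrite -[slice _ _]/[set: T] => h.
by rewrite -(@leeD2rE _ 1)// h add0e.
Qed.

(** [Ppi] is the countable sum of the measures [pi k] times the image of [P k] on the slice {k} x T,
    and nonnegative integrals are additive over such a sum. Every average over the prior below
    passes through this identity. *)
Lemma integral_joint (f : nat * T -> \bar R) :
  measurable_fun [set: nat * T] f -> (forall z, 0 <= f z) ->
  \int[Ppi]_z f z = \sum_(1 <= k <oo) (pi k)%:E * \int[P k]_w f (k, w).
Proof.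
move=> mf f0.
rewrite nneseries_shift1; last first.
  move=> k k1; rewrite mule_ge0 ?lee_fin ?(prior_ge0 prior)//.
  exact: integral_ge0.
pose c k := NngNum (prior_ge0 prior (ltn0Sn k)).
pose pr k : T -> nat * T := pair k.+1.
have mpr k : measurable_fun [set: T] (pr k) by exact: measurable_pair1.
pose m' k : {measure set (nat * T) -> \bar R} :=
  mscale (c k) (pushforward (P k.+1) (pr k)).
pose m_ := m' mpr.
rewrite (@eq_measure_integral _ _ _ _ (mseries m_ 0)); last first.
  move=> B mB _; apply: (etrans (joint_slices mB)); rewrite nneseries_recl//.
  rewrite joint0 ?add0e; last exact: measurable_slice.
  rewrite nneseries_shift1//.
  apply: eq_eseriesr => k _.
  by apply: joint => //; exact: measurable_slice.
rewrite ge0_integral_measure_series//; apply: eq_eseriesr => k _.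
rewrite ge0_integral_mscale//=; congr (_ * _).
by rewrite ge0_integral_pushforward.
Qed.

Lemma joint_measure (B : set (nat * T)) : measurable B ->
  Ppi B = \sum_(1 <= k <oo) (pi k)%:E * P k [set w | B (k, w)].
Proof.
move=> mB; transitivity (\int[Ppi]_z (\1_B z)%:E).
  by rewrite integral_indic// setIT.
rewrite integral_joint//.
- rewrite !nneseries_shift1.
  + apply: eq_eseriesr => k _; congr (_ * _).
    rewrite -[RHS]/(P k.+1 (slice B k.+1)) -[slice _ _]setIT.
    by rewrite -integral_indic//; exact: measurable_slice.
  + by move=> k k1; rewrite mule_ge0// lee_fin (prior_ge0 prior).
  + move=> k k1; rewrite mule_ge0 ?lee_fin ?(prior_ge0 prior)//.
    by apply: integral_ge0 => w _; rewrite lee_fin.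
- by apply/measurable_EFinP.
Qed.

End joint_law.

(** * First passage times and stopping times *)

Lemma first_timeP (p : pred nat) n :
  first_time p = Some n <-> p n /\ forall j, p j -> (n <= j)%N.
Proof.
rewrite /first_time; case: pselect => [h|h]; split => //.
- by case: ex_minnP => m pm minm [<-].
- case: ex_minnP => m pm minm [pn minn]; congr Some; apply/eqP.
  by rewrite eqn_leq minm// minn.
- by move=> [pn _]; exfalso; apply: h; exists n.
Qed.

Lemma first_time_le (p : pred nat) n :
  p n -> exists2 j, first_time p = Some j & (j <= n)%N.
Proof.
move=> pn; rewrite /first_time; case: pselect => [h|h].
  by exists (ex_minn h) => //; case: ex_minnP => j _; exact.
by exfalso; apply: h; exists n.
Qed.

Section stopping.
Context {R : realType} {d e : measure_display}
  {T : measurableType d} {E : measurableType e} {X : nat -> T -> E}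
  {tau : T -> option nat}.
Hypothesis mX : forall i, (1 <= i)%N -> measurable_fun setT (X i).
Hypothesis st : stopping_time X tau.

(** The gain of one index matters: with n = k + N the event is decided at time k + N - 1, after
    exactly N post-change observations. *)
Lemma obs_sigma_stop_lt n : (0 < n)%N ->
  obs_sigma X n.-1 [set w | ext_time (R := R) (tau w) < n%:R%:E].
Proof.
case: n => // n _.
rewrite (_ : [set _ | _] = [set w | exists2 j, tau w = Some j & (j <= n)%N]).
  exact: st.
apply/seteqP; split => w /=.
  by case: (tau w) => //= j; rewrite lte_fin ltr_nat => jn; exists j.
by move=> [j -> jn] /=; rewrite lte_fin ltr_nat.
Qed.

Lemma obs_sigma_stop_eq n : obs_sigma X n [set w | tau w = Some n].
Proof.
case: n => [|n].
  rewrite (_ : [set _ | _] = [set w | exists2 j, tau w = Some j & (j <= 0)%N]);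
    first exact: st.
  apply/seteqP; split => w /=; first by exists 0%N.
  by move=> [j -> ]; rewrite leqn0 => /eqP ->.
rewrite (_ : [set _ | _] = [set w | exists2 j, tau w = Some j & (j <= n.+1)%N] `\`
   [set w | exists2 j, tau w = Some j & (j <= n)%N]).
  apply: (@measurableD _ (filtered X n.+1)); first exact: st.
  exact: obs_sigma_mono (leqnSn n) (@st n).
apply/seteqP; split => w /=.
  move=> tw; split; first by exists n.+1.
  by move=> [j]; rewrite tw => -[<-]; rewrite ltnn.
move=> [[j tj jn] nj]; rewrite tj; congr Some; apply/eqP.
by rewrite eqn_leq jn/= ltnNge; apply/negP => jn'; apply: nj; exists j.
Qed.

Lemma measurable_ext_time :
  measurable_fun [set: T] (fun w => ext_time (R := R) (tau w)).
Proof.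
move=> _ B mB; rewrite setTI.
have meq n := obs_sigma_measurable mX (@obs_sigma_stop_eq n).
have mN : measurable [set w | tau w = None].
  rewrite (_ : [set _ | _] = ~` \bigcup_n [set w | tau w = Some n]).
    by apply: measurableC; exact: bigcupT_measurable.
  apply/seteqP; split => w /=; first by move=> tw [n _ /=]; rewrite tw.
  by case tw: (tau w) => [n|//] ntw; exfalso; apply: ntw; exists n.
rewrite (_ : _ @^-1` _ =
  (\bigcup_n (if (n%:R%:E : \bar R) \in B then [set w | tau w = Some n] else set0)) `|`
  (if (+oo : \bar R) \in B then [set w | tau w = None] else set0)).
  apply: measurableU; last by case: ifPn.
  by apply: bigcupT_measurable => n; case: ifPn.
apply/seteqP; split => w /=.
  case tw: (tau w) => [n|] /= wB; [left|right].
    by exists n => //; rewrite (mem_set wB).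
  by rewrite (mem_set wB).
move=> [[n _]|]; case: ifPn => //; rewrite inE => nB /= ->; exact: nB.
Qed.

End stopping.

(** * Change of measure, the statistic as a mixture density, and false alarms *)

Section model.
Context {R : realType} {d e : measure_display}
  {T : measurableType d} {E : measurableType e}
  {mu : {sigma_finite_measure set E -> \bar R}}
  {X : nat -> T -> E}
  {f0 : forall i : nat, i.-1.-tuple E -> E -> R}
  {f1 : forall k i : nat, i.-1.-tuple E -> E -> R}
  {Pinf : probability T R} {P : nat -> probability T R}.
Hypothesis model : changepoint_model mu X f0 f1 Pinf P.
Let mX := obs_measurable model.
Let Z := llr X f0 f1.

Lemma measurable_llrT k n : (1 <= k)%N -> measurable_fun [set: T] (Z k n).
Proof.
move=> k1; apply: (measurable_filtered mX (n := n)).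
exact: (measurable_llr model).
Qed.

(** Cut B at the level c of [Z k n]: below it the density is at most e^c, above it nothing is known
    and the overshoot pays. The lower piece is still in F_n, so the likelihood ratio identity
    applies to it. *)
Lemma change_of_measure_le k n B (c : R) : (1 <= k <= n)%N -> obs_sigma X n B ->
  P k B <= (expR c)%:E * Pinf B + P k [set w | c%:E <= Z k n w].
Proof.
move=> /andP[k1 kn] nB.
have mB := obs_sigma_measurable mX nB.
have mZ := measurable_llr model k1 (leqnn n).
pose C := B `&` [set w | Z k n w < c%:E].
have nC : obs_sigma X n C.
  exact: (@emeasurable_fun_infty_o _ (filtered X n) _ B _ nB (measurable_funTS mZ)).
have mc : measurable [set w | c%:E <= Z k n w].
  rewrite -[X in measurable X]setTI; apply: emeasurable_fun_c_infty => //.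
  exact: measurable_llrT.
have mC := obs_sigma_measurable mX nC.
apply: (@le_trans _ _ (P k C + P k [set w | c%:E <= Z k n w])).
  rewrite (le_trans _ (measureU2 _ _ _))//.
  apply: le_measure; rewrite ?inE//; first exact: measurableU.
  by move=> w Bw; have [|cw] := leP c%:E (Z k n w); [right|left].
rewrite leeD2r// (likelihood_ratio model k1 kn nC).
apply: (@le_trans _ _ (\int[Pinf]_(w in C) (expR c)%:E)).
  apply: ge0_le_integral => //.
  - by move=> w _; exact: expeR_ge0.
  - apply: measurable_funTS; apply: (measurableT_comp measurable_expeR).
    exact: measurable_llrT.
  - by move=> w [_ /= /ltW]; rewrite -lee_expeR.
rewrite integral_cst// lee_pmul2l// ?lte_fin ?expR_gt0//.
by apply: le_measure; rewrite ?inE// => w [].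
Qed.

Section prior.
Context { pi : nat -> R} {Ppi : probability (nat * T)%type R}.
Hypotheses (prior : is_prior pi) (joint : is_joint_law pi P Ppi).

Let pi_ge0 k : (1 <= k)%N -> 0 <= (pi k)%:E.
Proof. by move=> k1; rewrite lee_fin (prior_ge0 prior). Qed.

Lemma measurable_Gstat n p : (n <= p)%N ->
  measurable_fun [set: filtered X p] (Gstat pi Z n).
Proof.
move=> np; apply: emeasurable_funD => //.
rewrite (_ : (fun _ => _) = fun w => \sum_(1 <= k < n.+1)
    if (1 <= k)%N then (pi k)%:E * expeR (Z k n w) else 0); last first.
  by apply/funext => w; apply: eq_big_nat => k /andP[->].
apply: emeasurable_sum => k; have [k1|_] := boolP (1 <= k)%N; last by [].
apply: measurable_funeM; apply: (measurableT_comp measurable_expeR).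
exact: (measurable_llr model).
Qed.

Lemma tauA_stopping (A : R) : stopping_time X (tauA pi Z A).
Proof.
move=> n; rewrite (_ : [set _ | _] =
    \bigcup_(j in [set j | (1 <= j <= n)%N]) [set w | A%:E <= Gstat pi Z j w]).
  apply: (@bigcup_measurable _ (filtered X n)) => j /= /andP[_ jn].
  rewrite -[X in measurable X](setTI (T := filtered X n)).
  apply: emeasurable_fun_c_infty => //; exact: measurable_Gstat.
apply/seteqP; split => w /=.
  move=> [j /first_timeP[/= /andP[j1 Aj] _] jn].
  by exists j => //=; rewrite j1.
move=> [j /= /andP[j1 jn] Aj].
have [|i ti ij] := @first_time_le [pred n | (1 <= n)%N && (A%:E <= Gstat pi Z n w)] j.
  by rewrite /= j1.
by exists i => //; rewrite (leq_trans ij).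
Qed.

(** [Gstat] at time n is the Pinf-density on F_n of the mixture of the [P k]: change points k <= n
    enter through their likelihood ratios, and the constant tail of the statistic is the prior mass
    of the later ones, whose laws still coincide with Pinf. *)
Lemma integral_Gstat n B : obs_sigma X n B ->
  \int[Pinf]_(w in B) Gstat pi Z n w = Ppi (setT `*` B).
Proof.
move=> nB; have mB := obs_sigma_measurable mX nB.
have u0 k : (1 <= k)%N -> 0 <= (pi k)%:E * P k B.
  by move=> k1; rewrite mule_ge0// pi_ge0.
pose Q := \sum_(n.+1 <= j <oo) (pi j)%:E.
have Q0 : 0 <= Q.
  by apply: nneseries_ge0 => k nk _; rewrite pi_ge0// (leq_trans _ nk).
have QE : Q * Pinf B = \sum_(n.+1 <= k <oo) (pi k)%:E * P k B.
  rewrite muleC [X in X * _](_ : _ = (fine (Pinf B))%:E);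
    last by rewrite fineK// fin_num_measure.
  rewrite /Q [in LHS]nneseries_shift; last first.
    by move=> k nk; rewrite pi_ge0// (leq_trans _ nk).
  rewrite [RHS]nneseries_shift; last first.
    by move=> k nk; rewrite u0// (leq_trans _ nk).
  rewrite -nneseriesZl; last by move=> k _; rewrite pi_ge0.
  apply: eq_eseriesr => k _; rewrite fineK ?fin_num_measure// muleC.
  by rewrite (prechange_agree model _ nB)// leq_addr.
have mt k : (1 <= k)%N -> measurable_fun B (fun w => (pi k)%:E * expeR (Z k n w)).
  move=> k1; apply: measurable_funTS; apply: measurable_funeM.
  apply: (measurableT_comp measurable_expeR); exact: measurable_llrT.
rewrite (joint_measure prior joint)//; last exact: measurableX.
rewrite (_ : \sum_(1 <= k <oo) _ = \sum_(1 <= k <oo) (pi k)%:E * P k B); last first.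
  congr (limn _); apply/funext => j; apply: eq_bigr => k _.
  by congr (_ * P k _); apply/seteqP; split => w //= [].
rewrite (nneseries_split 1 n)// add1n /Gstat -/Q.
have sumE w : \sum_(1 <= k < n.+1) (pi k)%:E * expeR (Z k n w) =
   \sum_(k < n) (pi k.+1)%:E * expeR (Z k.+1 n w).
  by rewrite big_add1 big_mkord.
under eq_integral do rewrite sumE.
rewrite ge0_integralD//; last 2 first.
- by move=> w _; apply: sume_ge0 => k _; rewrite mule_ge0 ?pi_ge0// expeR_ge0.
- by apply: emeasurable_sum => k; exact: mt.
congr (_ + _).
  rewrite ge0_integral_sum//; last 2 first.
  - by move=> k; exact: mt.
  - by move=> k w _; rewrite mule_ge0 ?pi_ge0// expeR_ge0.
  rewrite big_add1 big_mkord; apply: eq_bigr => k _.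
  rewrite ge0_integralZl_EFin//; last 3 first.
  - by move=> w _; exact: expeR_ge0.
  - apply: measurable_funTS; apply: (measurableT_comp measurable_expeR).
    exact: measurable_llrT.
  - exact: (prior_ge0 prior).
  by rewrite (likelihood_ratio model _ _ nB).
by rewrite -QE integral_cst.
Qed.

Lemma false_alarm (A : R) : (0 < A)%R ->
  Pinf [set w | exists j, tauA pi Z A w = Some j] <= (A^-1)%:E.
Proof.
move=> A0; pose C n := [set w | tauA pi Z A w = Some n].
have nC n : obs_sigma X n (C n) by exact: obs_sigma_stop_eq (@tauA_stopping A) n.
have mC n := obs_sigma_measurable mX (nC n).
have tC : trivIset setT C.
  by move=> i j _ _ [w []]; rewrite /C /= => -> [].
rewrite (_ : [set _ | _] = \bigcup_n C n); last first.
  by apply/seteqP; split => w [j]; [exists j|move=> _ ?; exists j].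
rewrite -(@lee_pmul2l _ A%:E) ?lte_fin// -EFinM divff ?gt_eqF//.
rewrite measure_semi_bigcup//; last exact: bigcupT_measurable.
rewrite -nneseriesZl//.
apply: (@le_trans _ _ (\sum_(n <oo) Ppi (setT `*` C n))).
  apply: lee_nneseries => n _ /=; first by rewrite mule_ge0// lee_fin ltW.
  rewrite -(integral_Gstat (nC n)) -integral_cst//.
  apply: ge0_le_integral => //.
  - by move=> w _; rewrite lee_fin ltW.
  - apply: measurable_funTS; apply: (measurable_filtered mX (n := n)).
    exact: measurable_Gstat.
  - by move=> w /first_timeP[/= /andP[_ Aj] _].
rewrite -measure_semi_bigcup.
- by apply: probability_le1; apply: bigcupT_measurable => n; exact: measurableX.
- by move=> n; exact: measurableX.
- by move=> i j _ _ [[k w] [[_ +] [_]]]; rewrite /C /= => -> [].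
- by apply: bigcupT_measurable => n; exact: measurableX.
Qed.

Lemma tauA_Delta_inf (alpha : R) : (0 < alpha)%R ->
  Delta_inf X Pinf alpha (tauA pi Z alpha^-1).
Proof.
move=> a0; split; first exact: tauA_stopping.
by rewrite (le_trans (false_alarm _)) ?invr_gt0// invrK.
Qed.

End prior.
End model.

Lemma measurable_bigmaxe {R : realType} {d : measure_display}
    {T : measurableType d} (I : Type) (s : seq I) (f : I -> T -> \bar R) :
  (forall i, measurable_fun setT (f i)) ->
  measurable_fun setT (fun w => \big[maxe/-oo]_(i <- s) f i w).
Proof.
move=> mf; elim: s => [|i s IH].
  by rewrite (_ : (fun _ => _) = cst -oo)//; apply/funext => w; rewrite big_nil.
rewrite (_ : (fun _ => _) = fun w => maxe (f i w) (\big[maxe/-oo]_(i <- s) f i w)).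
  exact: measurable_maxe.
by apply/funext => w; rewrite big_cons.
Qed.

Lemma near_ln_ge {R : realType} (C : R) : \forall A \near +oo%R, (C <= ln A)%R.
Proof.
near=> A; have CA : (expR C <= A)%R by near: A; exact: nbhs_pinfty_ge.
by rewrite -(expRK C) ler_ln ?posrE ?expR_gt0// (lt_le_trans _ CA)// expR_gt0.
Unshelve. all: by end_near. Qed.

(** * Measurability of the delay and a Markov bound for its moments *)

Section delay.
Context {R : realType} {d e : measure_display}
  {T : measurableType d} {E : measurableType e} {X : nat -> T -> E}
  {tau : T -> option nat}.
Hypothesis mX : forall i, (1 <= i)%N -> measurable_fun setT (X i).
Hypothesis st : stopping_time X tau.
Let extt (z : nat * T) : \bar R := ext_time (tau z.2).

Let measurable_extt : measurable_fun setT extt.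
Proof. exact: (measurableT_comp (measurable_ext_time mX st)). Qed.

Let measurable_shift N :
  measurable_fun [set: nat * T] (fun z => (z.1 + N)%:R%:E : \bar R).
Proof. by apply: measurable_nat_prod => k /=; exact: measurable_cst. Qed.

Lemma measurable_detected N :
  measurable [set z : nat * T | (z.1 + N)%:R%:E <= extt z].
Proof.
rewrite -[X in measurable X]setTI.
exact: measurable_lee.
Qed.

Lemma measurable_delay (m : R) :
  measurable_fun [set: nat * T] (fun z => (extt z - z.1%:R%:E) `^ m).
Proof.
apply: (measurableT_comp (measurable_poweR m)).
apply: emeasurable_funB => //.
by rewrite (_ : (fun _ => _) = fun z => (z.1 + 0)%:R%:E)//;
  apply/funext => z; rewrite addn0.
Qed.

(** Markov's inequality on the event of a delay of at least N; the normalisation by the probability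
    of the conditioning event, at most 1, can only increase the quotient. *)
Lemma delay_moment_ge (Ppi : probability (nat * T)%type R) (m : R) N :
  (0 < m)%R -> 0 < Ppi [set z | (z.1 + N)%:R%:E <= extt z] ->
  ((N%:R `^ m)%R)%:E * Ppi [set z | (z.1 + N)%:R%:E <= extt z] <=
    delay_moment Ppi m tau.
Proof.
move=> m0; set S := [set z | _]; set S0 := [set z : nat * T | z.1%:R%:E <= extt z].
move=> PS0; have mS : measurable S by exact: measurable_detected.
have mS0 : measurable S0.
  rewrite (_ : S0 = [set z : nat * T | (z.1 + 0)%:R%:E <= extt z]).
    exact: measurable_detected.
  by apply/seteqP; split => z /=; rewrite /S0/= addn0.
have SS0 : S `<=` S0.
  by move=> z; apply: le_trans; rewrite lee_fin ler_nat leq_addr.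
have PSS0 : Ppi S <= Ppi S0 by apply: le_measure; rewrite ?inE.
rewrite /delay_moment /cond_expectation -/S0.
have finS0 : Ppi S0 \is a fin_num by rewrite fin_num_measure.
have S0gt0 : (0 < fine (Ppi S0))%R.
  by rewrite fine_gt0// (lt_le_trans PS0)//= ltey_eq finS0.
have cE : Ppi S0 = (fine (Ppi S0))%:E by rewrite fineK.
rewrite [X in _ / X]cE inver gt_eqF// lee_pdivlMr// -cE.
apply: (@le_trans _ _ ((N%:R `^ m)%:E * Ppi S)).
  rewrite -[leRHS]mule1; apply: lee_pmul => //.
  - by rewrite mule_ge0// lee_fin powR_ge0.
  - exact: probability_le1.
apply: (@le_trans _ _ (\int[Ppi]_(z in S) (extt z - z.1%:R%:E) `^ m)); last first.
  apply: ge0_subset_integral => //; last by move=> z _; exact: poweR_ge0.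
  exact: measurable_funTS (measurable_delay m).
rewrite -integral_cst//; apply: ge0_le_integral => //.
- by move=> z _; rewrite lee_fin powR_ge0.
- exact: measurable_funTS (measurable_delay m).
- move=> z Sz; rewrite /cst -poweR_EFin.
  have NS : N%:R%:E <= extt z - z.1%:R%:E.
    by rewrite leeBrDr// -EFinD -natrD addnC.
  apply: gt0_ler_poweR => //; rewrite ?in_itv/= ?leey ?andbT ?lee_fin ?ler0n//.
    exact: ltW.
  by apply: le_trans NS; rewrite lee_fin.
Qed.

End delay.

(** * Lower bound, uniform over all procedures in [Delta_inf] *)

Section lower_bound.
Context {R : realType} {d e : measure_display}
  {T : measurableType d} {E : measurableType e}
  {mu : {sigma_finite_measure set E -> \bar R}}
  {X : nat -> T -> E}
  {f0 : forall i : nat, i.-1.-tuple E -> E -> R}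
  {f1 : forall k i : nat, i.-1.-tuple E -> E -> R}
  {Pinf : probability T R} {P : nat -> probability T R}.
Context { pi : nat -> R} {Ppi : probability (nat * T)%type R}.
Hypothesis model : changepoint_model mu X f0 f1 Pinf P.
Hypotheses (prior : is_prior pi) (joint : is_joint_law pi P Ppi).
Let mX := obs_measurable model.
Let Z := llr X f0 f1.
Variable q : R.
Hypothesis q_gt0 : (0 < q)%R.

Let overshoot (eps : R) k M : set T :=
  [set w | ((1 + eps) * q)%:E <=
    (M%:R^-1)%:E * \big[maxe/-oo]_(1 <= n < M.+1) Z k (k + n - 1)%N w].

Hypothesis cond_a : forall (eps : R) (k : nat), (0 < eps)%R -> (1 <= k)%N ->
  P k (overshoot eps k M) @[M --> \oo] --> (0 : \bar R).

Let measurable_overshoot eps k M : (1 <= k)%N -> measurable (overshoot eps k M).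
Proof.
move=> k1; rewrite -[X in measurable X]setTI; apply: emeasurable_fun_c_infty => //.
apply: measurable_funeM; apply: measurable_bigmaxe => n.
exact: (measurable_llrT model).
Qed.

Lemma early_detection_le eps k N (alpha : R) (tau : T -> option nat) :
  (1 <= k)%N -> (1 <= N)%N -> Delta_inf X Pinf alpha tau ->
  P k [set w | ext_time (R := R) (tau w) < (k + N)%:R%:E] <=
  (expR ((1 + eps) * q * N%:R) * alpha)%:E + P k (overshoot eps k N).
Proof.
move=> k1 N1 [st fa].
have kN : (0 < k + N)%N by rewrite addn_gt0 k1.
have nB := obs_sigma_stop_lt (R := R) st kN.
have kn : (1 <= k <= (k + N).-1)%N.
  by rewrite k1 -ltnS prednK//= -[ltnLHS]addn0 ltn_add2l.
apply: le_trans (change_of_measure_le model ((1 + eps) * q * N%:R) kn nB) _.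
apply: leeD.
  rewrite EFinM lee_pmul2l// ?lte_fin ?expR_gt0//.
  apply: le_trans fa; apply: le_measure; rewrite ?inE.
  - exact: (obs_sigma_measurable mX nB).
  - rewrite (_ : [set _ | _] = \bigcup_n [set w | tau w = Some n]).
      apply: bigcupT_measurable => n.
      apply: (obs_sigma_measurable mX (n := n)); exact: (obs_sigma_stop_eq st).
    by apply/seteqP; split => w [j]; [exists j|move=> _ ?; exists j].
  - by move=> w /=; case: (tau w) => // j _; exists j.
apply: le_measure; rewrite ?inE.
- rewrite -[X in measurable X]setTI; apply: emeasurable_fun_c_infty => //.
  exact: (measurable_llrT model).
- exact: measurable_overshoot.
- move=> w /= cZ; rewrite /overshoot/= muleC lee_pdivlMr ?ltr0n// -EFinM.
  apply: (le_trans cZ); rewrite -subn1.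
  (* The entry n = N of the maximum is Z at time k + N - 1. *)
  by apply: (@le_bigmax_seq _ _ _ _ -oo N xpredT (fun n => Z k (k + n - 1)%N w));
    rewrite // mem_index_iota N1 ltnSn.
Qed.

(** The series is the [Ppi]-integral of a function of the change point bounded by 1, so pointwise
    convergence in k, which is all that [cond_a] gives, passes to the sum. *)
Lemma overshoot_cvg0 eps : (0 < eps)%R ->
  \sum_(1 <= k <oo) (pi k)%:E * P k (overshoot eps k N) @[N --> \oo]
    --> (0 : \bar R).
Proof.
move=> eps0.
(* The value 0 at index 0 is a default, as [cond_a] covers only k >= 1. *)
pose f N (z : nat * T) := if z.1 is 0%N then 0 else P z.1 (overshoot eps z.1 N).
have f0' N z : 0 <= f N z by rewrite /f; case: (z.1).
have mf N : measurable_fun setT (f N).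
  by apply: measurable_nat_prod => k; rewrite /f/=; exact: measurable_cst.
rewrite (_ : (fun _ => _) = fun N => \int[Ppi]_z f N z); last first.
  apply/funext => N; rewrite (integral_joint prior joint)//.
  rewrite !nneseries_shift1.
  - apply: eq_eseriesr => k _; rewrite /f/= integral_cst//.
    by rewrite [X in _ * (_ * X)](probability_setT (P k.+1)) mule1.
  - move=> k k1; rewrite mule_ge0 ?lee_fin ?(prior_ge0 prior)//.
    by apply: integral_ge0 => w _; exact: f0'.
  - by move=> k k1; rewrite mule_ge0 ?lee_fin ?(prior_ge0 prior).
have [] := @dominated_convergence _ _ _ Ppi setT measurableT f (cst 0) (cst 1)
  mf _ _ _ _.
- exact: measurable_cst.
- apply: aeW => -[k w] _; rewrite /f/=; case: k => [|k]; first exact: cvg_cst.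
  exact: cond_a.
- exact: finite_measure_integrable_cst.
- apply: aeW => -[k w] N _; rewrite gee0_abs// /f/=.
  by case: k => [|k] //; apply: probability_le1; exact: measurable_overshoot.
- by move=> _ _; rewrite integral_cst// mul0e.
Qed.

Lemma late_detection_near eps eta : (0 < eps)%R -> (eps < 1)%R -> (0 < eta)%R ->
  \forall A \near +oo%R, forall tau, Delta_inf X Pinf A^-1 tau ->
  (1 - eta)%:E <= Ppi [set z | (z.1 + Num.truncn ((1 - eps) * (ln A / q)))%:R%:E
                               <= ext_time (R := R) (tau z.2)].
Proof.
move=> eps0 eps1 eta0.
have eta2 : (0 < eta / 2)%R by rewrite divr_gt0.
have eps1' : (0 < 1 - eps)%R by rewrite subr_gt0.
have [N0 _ hN0] : \forall N \near \oo,
    \sum_(1 <= k <oo) (pi k)%:E * P k (overshoot eps k N) < (eta / 2)%:E.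
  move: (overshoot_cvg0 eps0) => /(_ [set y | y < (eta / 2)%:E]); apply.
  apply: open_nbhs_nbhs; split; first exact: open_ereal_lt_ereal.
  by rewrite /= lte_fin.
near=> A => tau [st fa].
have A0 : (0 < A)%R by near: A; exact: nbhs_pinfty_gt.
have s0 : (0 <= ln A)%R by near: A; exact: near_ln_ge.
(* Ensures N >= 1, since the overshoot event divides by N, and N >= [N0]. *)
have N0s : ((maxn 1 N0)%:R / (1 - eps) * q <= ln A)%R.
  by near: A; exact: near_ln_ge.
(* The exponent of the change of measure is at most (1 + eps)(1 - eps) ln A - ln A = - eps^2 ln A,
   which this threshold pushes below ln (eta / 2). *)
have sbig : (- ln (eta / 2) / eps ^+ 2 <= ln A)%R by near: A; exact: near_ln_ge.
set s := ln A in s0 N0s sbig *.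
set x := ((1 - eps) * (s / q))%R; set N := Num.truncn x.
have x0 : (0 <= x)%R by rewrite mulr_ge0 ?divr_ge0// ltW.
have N0x : ((maxn 1 N0)%:R <= x)%R.
  by rewrite /x mulrC -ler_pdivrMr// ler_pdivlMr.
have := N0x; rewrite -truncn_ge_nat// -/N geq_max => /andP[N1 N0N].
have Nx : (N%:R <= x)%R by rewrite truncn_le.
set c := (expR ((1 + eps) * q * N%:R) * A^-1)%R.
have c0 : (0 <= c)%R by rewrite mulr_ge0 ?expR_ge0// invr_ge0 ltW.
have cle : (c <= eta / 2)%R.
  rewrite /c -[A]lnK ?posrE// -expRN -expRD -/s -[leRHS]lnK ?posrE//.
  rewrite ler_expR; apply: (@le_trans _ _ (- (eps ^+ 2 * s))%R).
    rewrite lerBlDr.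
    apply: (@le_trans _ _ ((1 + eps) * q * x)%R).
      by rewrite ler_pM2l// mulr_gt0// addr_gt0.
    rewrite /x le_eqVlt; apply/orP; left; apply/eqP.
    by field; rewrite gt_eqF.
  by rewrite lerNl [leRHS]mulrC -ler_pdivrMr ?exprn_gt0.
set B := [set z | _].
have mB : measurable B by exact: (measurable_detected mX st).
have mC : measurable (~` B) by exact: measurableC.
rewrite -[B]setCK probability_setC// EFinB leeB//.
rewrite (joint_measure prior joint)//.
have pi0 k : 0 <= (pi k.+1)%:E by rewrite lee_fin (prior_ge0 prior).
rewrite nneseries_shift1; last first.
  by move=> k k1; rewrite mule_ge0// lee_fin (prior_ge0 prior).
apply: (@le_trans _ _ (\sum_(k <oo) ((pi k.+1)%:E * c%:E +
                         (pi k.+1)%:E * P k.+1 (overshoot eps k.+1 N)))).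
  apply: lee_nneseries => k _; first by rewrite mule_ge0.
  rewrite -ge0_muleDr//; apply: lee_wpmul2l => //.
  apply: le_trans (early_detection_le eps _ N1 (conj st fa)) => //.
  rewrite le_eqVlt; apply/orP; left; apply/eqP; congr (P k.+1 _).
  by apply/seteqP; split => w; rewrite /B/= ltNge => /negP.
rewrite nneseriesD//; last 2 first.
- by move=> k _ _; rewrite mule_ge0.
- by move=> k _ _; rewrite mule_ge0.
rewrite (splitr eta) EFinD; apply: leeD.
  under eq_eseriesr do rewrite muleC.
  rewrite nneseriesZl// -(nneseries_shift1 (u := fun k => (pi k)%:E)).
    by rewrite (prior_sum1 prior) mule1 lee_fin.
  by move=> k k1; rewrite lee_fin (prior_ge0 prior).
rewrite -(nneseries_shift1 (u := fun k => (pi k)%:E * P k (overshoot eps k N))).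
  by apply/ltW/hN0.
by move=> k k1; rewrite mule_ge0// lee_fin (prior_ge0 prior).
Unshelve. all: by end_near. Qed.

(** A delay of at least N implies tau >= lambda, so the uniform bound, taken here with eps = 1/2,
    also controls the denominator of the delay moment. *)
Lemma detection_probability_near (tau : R -> T -> option nat) eta : (0 < eta)%R ->
  (forall A, (0 < A)%R -> Delta_inf X Pinf A^-1 (tau A)) ->
  \forall A \near +oo%R,
    (1 - eta)%:E <= Ppi [set z | z.1%:R%:E <= ext_time (R := R) (tau A z.2)].
Proof.
move=> eta0 Dtau; near=> A.
have A0 : (0 < A)%R by near: A; exact: nbhs_pinfty_gt.
have h : forall tau, Delta_inf X Pinf A^-1 tau ->
  (1 - eta)%:E <= Ppi [set z | (z.1 + Num.truncn ((1 - 2^-1) * (ln A / q)))%:R%:E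
                               <= ext_time (R := R) (tau z.2)].
  by near: A; apply: late_detection_near => //; rewrite ?invr_gt0// invf_lt1 ?ltr1n.
apply: le_trans (h _ (Dtau _ A0)) _.
have [st _] := Dtau _ A0.
have m0 := measurable_detected (R := R) mX st 0.
rewrite (_ : [set z | z.1%:R%:E <= _] =
    [set z | (z.1 + 0)%:R%:E <= ext_time (R := R) (tau A z.2)]); last first.
  by apply/seteqP; split => z /=; rewrite addn0.
apply: le_measure; rewrite ?inE//; first exact: (measurable_detected mX st).
by move=> z /=; apply: le_trans; rewrite lee_fin ler_nat leq_add2l.
Unshelve. all: by end_near. Qed.

Lemma delay_moment_lower (m eta : R) : (0 < m)%R -> (0 < eta)%R -> (eta < 1)%R ->
  \forall A \near +oo%R, forall tau, Delta_inf X Pinf A^-1 tau ->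
    ((1 - eta) * (ln A / q) `^ m)%:E <= delay_moment Ppi m tau.
Proof.
move=> m0 eta0 eta1.
have eta2 : (0 < eta / 2)%R by rewrite divr_gt0.
have eta2' : (0 < 1 - eta / 2)%R by lra.
(* Half of eta is spent on the length of the delay, as c^m = 1 - eta/2, and half on its probability;
   (1 - eta/2)^2 >= 1 - eta. With [eps] below, c = 1 - 2 eps: one [eps] shortens the delay, the
   other absorbs the truncation to an integer. *)
pose c := ((1 - eta / 2) `^ m^-1)%R.
have c0 : (0 < c)%R by rewrite powR_gt0.
have cm : (c `^ m = 1 - eta / 2)%R by rewrite /c -powRrM mulVf ?gt_eqF// powRr1// ltW.
have c1 : (c < 1)%R.
  rewrite ltNge; apply/negP => c1.
  have := ge0_ler_powR (ltW m0) (x := 1%R) (y := c).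
  by rewrite !nnegrE powR1 cm => /(_ ler01 (ltW c0) c1); lra.
pose eps := ((1 - c) / 2)%R.
near=> A => tau Dtau.
have s0 : (0 <= ln A)%R by near: A; exact: near_ln_ge.
(* Makes eps (ln A / q) at least 1, which is what truncation can cost. *)
have sq : (q / eps <= ln A)%R by near: A; exact: near_ln_ge.
have h : forall tau, Delta_inf X Pinf A^-1 tau ->
  (1 - eta / 2)%:E <= Ppi [set z | (z.1 + Num.truncn ((1 - eps) * (ln A / q)))%:R%:E
                               <= ext_time (R := R) (tau z.2)].
  by near: A; apply: late_detection_near => //; rewrite /eps; lra.
have {h} h := h _ Dtau.
have [st _] := Dtau.
apply: (le_trans _ (delay_moment_ge mX st m0 (lt_le_trans _ h))); last by rewrite lte_fin.
set N := Num.truncn _.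
have eps0 : (0 < eps)%R by rewrite /eps; lra.
have cN : (c * (ln A / q) <= N%:R)%R.
  have : (1 <= eps * (ln A / q))%R.
    by rewrite mulrA ler_pdivlMr// mul1r mulrC -ler_pdivrMr.
  have := truncnS_gt ((1 - eps) * (ln A / q)); rewrite -/N -natr1.
  rewrite (_ : c = 1 - eps - eps)%R; last by rewrite /eps; lra.
  by set y := (ln A / q)%R; nra.
have y0 : (0 <= ln A / q)%R by rewrite divr_ge0// ltW.
apply: (@le_trans _ _ ((c * (ln A / q)) `^ m * (1 - eta / 2))%:E).
  rewrite lee_fin; move: (ln A / q)%R y0 => y y0.
  rewrite (powRM _ (ltW c0) y0) cm.
  by have := powR_ge0 y m; move: (y `^ m)%R => v v0; nra.
rewrite EFinM; apply: lee_pmul => //.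
- by rewrite lee_fin powR_ge0.
- by rewrite lee_fin ltW.
- rewrite lee_fin; apply: ge0_ler_powR => //; first exact: ltW.
  + by rewrite nnegrE mulr_ge0// ltW.
  + by rewrite nnegrE ler0n.
Unshelve. all: by end_near. Qed.
End lower_bound.

(** * Elementary inequalities for powers and quotients *)

Lemma powR_split {R : realType} (m delta a y : R) : (0 < m)%R -> (0 < delta)%R ->
  (0 <= a)%R -> (0 <= y)%R ->
  ((a + y) `^ m <= (1 + delta) `^ m * a `^ m + (1 + delta^-1) `^ m * y `^ m)%R.
Proof.
move=> m0 d0 a0 y0.
have d1 : (0 <= 1 + delta)%R by rewrite addr_ge0// ltW.
have d2 : (0 <= 1 + delta^-1)%R by rewrite addr_ge0// invr_ge0 ltW.
rewrite -(powRM _ d1 a0) -(powRM _ d2 y0).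
(* Either y <= delta a or a <= delta^-1 y, and one term alone dominates. *)
have mono (u v : R) : (0 <= u)%R -> (u <= v)%R -> (u `^ m <= v `^ m)%R.
  move=> u0 uv; apply: ge0_ler_powR => //; rewrite ?nnegrE//; first exact: ltW.
  exact: le_trans uv.
have [yda|/ltW ady] := leP y (delta * a)%R.
  rewrite -[leLHS]addr0; apply: lerD; last exact: powR_ge0.
  by apply: mono; [exact: addr_ge0|rewrite mulrDl mul1r lerD2l].
rewrite -[leLHS]add0r; apply: lerD; first exact: powR_ge0.
apply: mono; first exact: addr_ge0.
by rewrite mulrDl mul1r addrC lerD2l mulrC ler_pdivlMr// mulrC.
Qed.

(** Here a is the part growing with ln A, x the last entry time and b the prior term. A first split
    with [delta] isolates a; a second with delta = 1, the source of the factor 2, separates x from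
    b. Only the r-th moment of x is controlled, hence x^m <= 1 + x^r. *)
Lemma poweR_delay_bound {R : realType} (m r delta a b : R) (x : \bar R) :
  (0 < m)%R -> (m <= r)%R -> (0 < delta)%R -> (0 <= a)%R -> (0 <= b)%R -> 0 <= x ->
  (x + (a + b)%:E) `^ m <= ((1 + delta) `^ m * a `^ m)%:E +
     (((1 + delta^-1) * 2) `^ m)%:E * (1 + x `^ r + (b `^ m)%:E).
Proof.
move=> m0 mr d0 a0 b0; have r0 := lt_le_trans m0 mr.
have d2 : (0 < 1 + delta^-1)%R by rewrite addr_gt0// invr_gt0.
have K0 : (0 < ((1 + delta^-1) * 2) `^ m)%R by rewrite powR_gt0// mulr_gt0.
case: x => [x||//]; last first.
  move=> _; rewrite (poweRyr (lt0r_neq0 r0)) addey// addye// gt0_muley ?lte_fin//.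
  by rewrite addey// leey.
rewrite lee_fin => x0; rewrite -EFinD !poweR_EFin.
suff : ((x + (a + b)) `^ m <= (1 + delta) `^ m * a `^ m +
    ((1 + delta^-1) * 2) `^ m * (1 + x `^ r + b `^ m))%R by [].
rewrite (_ : x + (a + b) = a + (x + b))%R; last by rewrite addrCA.
apply: le_trans (powR_split m0 d0 a0 (addr_ge0 x0 b0)) _.
rewrite lerD2l (powRM _ (ltW d2))// -mulrA ler_pM2l ?powR_gt0//.
apply: le_trans (powR_split m0 ltr01 x0 b0) _.
rewrite invr1 (_ : 1 + 1 = 2)%R// -mulrDr ler_pM2l ?powR_gt0// lerD2r.
have [x1|/ltW x1] := leP 1%R x.
  by apply: le_trans (ler_powR x1 mr) _; rewrite lerDr.
apply: (@le_trans _ _ 1%R); last by rewrite lerDl powR_ge0.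
have p1 : (1 `^ m = 1 :> R)%R by rewrite powR1.
rewrite -[leRHS]p1; apply: ge0_ler_powR => //; rewrite ?nnegrE//.
exact: ltW.
Qed.

(** Three errors of size h, in the leading coefficient, the additive constant and the denominator,
    are merged into one. The constant 6 is generous: 1 + 2h <= (1 + 6h)(1 - h) holds already for 0 <
    h <= 1/2. *)
Lemma quotient_margin {R : realFieldType} (h Y C c : R) :
  (0 < h)%R -> (h < 6^-1)%R -> (0 <= Y)%R -> (C <= h * Y)%R -> (1 - h <= c)%R ->
  ((1 + h) * Y + C <= (1 + 6 * h) * Y * c)%R.
Proof.
move=> h0 h6 Y0 CY hc.
apply: (@le_trans _ _ ((1 + h + h) * Y)%R); first by rewrite [leRHS]mulrDl lerD2l.
have hc' : ((1 + 6 * h) * Y * (1 - h) <= (1 + 6 * h) * Y * c)%R.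
  by rewrite ler_wpM2l// mulr_ge0//; lra.
apply: le_trans hc'; rewrite mulrAC; apply: ler_wpM2r => //.
by clear -h0 h6; nra.
Qed.

(** * Upper bound for the delay moments of [tauA] *)

Section upper_bound.
Context {R : realType} {d e : measure_display}
  {T : measurableType d} {E : measurableType e}
  {mu : {sigma_finite_measure set E -> \bar R}}
  {X : nat -> T -> E}
  {f0 : forall i : nat, i.-1.-tuple E -> E -> R}
  {f1 : forall k i : nat, i.-1.-tuple E -> E -> R}
  {Pinf : probability T R} {P : nat -> probability T R}.
Context { pi : nat -> R} {Ppi : probability (nat * T)%type R}.
Hypothesis model : changepoint_model mu X f0 f1 Pinf P.
Hypotheses (prior : is_prior pi) (joint : is_joint_law pi P Ppi).
Let mX := obs_measurable model.
Let Z := llr X f0 f1.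
Variable q : R.
Hypothesis q_gt0 : (0 < q)%R.

Lemma last_entry_ge0 eps k w : 0 <= last_entry Z q eps k w.
Proof. by apply: ereal_sup_ubound; left. Qed.

Lemma measurable_last_entry eps k : (1 <= k)%N ->
  measurable_fun setT (last_entry Z q eps k).
Proof.
move=> k1.
pose C n := [set w | (n%:R^-1)%:E * Z k (k + n - 1)%N w - q%:E < (- eps)%:E].
(* Turns the supremum into that of a sequence of measurable functions; index 0 always contributes
   the value 0 of the empty supremum. *)
pose g n w : \bar R := if (1 <= n)%N && (w \in C n) then n%:R%:E else 0.
rewrite (_ : last_entry _ _ _ _ = fun w => esups (g ^~ w) 0%N).
  apply: measurable_fun_esups => n; rewrite /g.
  case: (1 <= n)%N => //=; apply: measurable_fun_ifT => //.
  apply: (measurable_fun_bool true).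
  rewrite (_ : _ @^-1` _ = C n); last first.
    by apply/seteqP; split => w; [exact: set_mem|exact: mem_set].
  apply: emeasurable_fun_infty_o => //; apply: emeasurable_funB => //.
  by apply: measurable_funeM; exact: (measurable_llrT model).
apply/funext => w; rewrite /last_entry /esups/=; congr ereal_sup.
apply/seteqP; split => x /=.
  move=> [->|[n [n1 Cn] <-]]; first by exists 0%N.
  by exists n => //; rewrite /g n1/= ifT// inE.
move=> [n _ <-]; rewrite /g; case: ifPn => [/andP[n1]|_]; last by left.
by rewrite inE => Cn; right; exists n.
Qed.

Lemma Gstat_ge k n w : (1 <= k <= n)%N ->
  (pi k)%:E * expeR (Z k n w) <= Gstat pi Z n w.
Proof.
move=> /andP[k1 kn].
have t0 j : (1 <= j)%N -> 0 <= (pi j)%:E * expeR (Z j n w).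
  by move=> j1; rewrite mule_ge0 ?lee_fin ?(prior_ge0 prior)// expeR_ge0.
rewrite /Gstat -[leLHS]adde0; apply: leeD; last first.
  by apply: nneseries_ge0 => j nj _; rewrite lee_fin (prior_ge0 prior)// (leq_trans _ nj).
rewrite (bigD1_seq k)/= ?mem_index_iota ?k1 ?ltnS ?iota_uniq//.
rewrite -[leLHS]adde0 leeD2l// big_seq_cond; apply: sume_ge0 => j.
by rewrite mem_index_iota => /andP[/andP[j1 _] _]; exact: t0.
Qed.

Lemma tauA_delay_le (A eps : R) k w : (0 < pi k)%R -> (1 <= k)%N ->
  (1 <= A)%R -> (0 < eps)%R -> (eps < q)%R ->
  ext_time (tauA pi Z A w) - k%:R%:E <=
    last_entry Z q eps k w + (ln A / (q - eps) + `|ln (pi k)| / (q - eps))%:E.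
Proof.
move=> pk0 k1 A1 eps0 epsq; have qe : (0 < q - eps)%R by rewrite subr_gt0.
have A0 : (0 < A)%R by exact: lt_le_trans A1.
set L := (ln A / _ + _)%R.
have L0 : (0 <= L)%R by rewrite addr_ge0// divr_ge0 ?ln_ge0// ltW.
case tE : (last_entry Z q eps k w) (last_entry_ge0 eps k w) => [t||//] t0; last first.
  by rewrite addye// leey.
rewrite lee_fin in t0.
(* The least integer strictly above t + L: exceeding t puts it past the last entry, exceeding L
   lifts pi_k e^Z to A. Stopping occurs by time k + n - 1, so the delay is at most n - 1 and the
   rounding up costs nothing. *)
pose n := (Num.truncn (t + L)).+1.
have nt : (t + L < n%:R)%R by exact: truncnS_gt.
have n0 : (0 < n%:R :> R)%R by rewrite ltr0n.
have Zn : ((q - eps) * n%:R)%:E <= Z k (k + n - 1)%N w.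
  have : ~ ((n%:R^-1)%:E * Z k (k + n - 1)%N w - q%:E < (- eps)%:E).
    move=> h; have : n%:R%:E <= last_entry Z q eps k w.
      by apply: ereal_sup_ubound; right; exists n.
    by rewrite tE lee_fin => nt'; lra.
  move=> /negP; rewrite -leNgt leeBrDr// -EFinD (addrC (- eps)%R) muleC.
  by rewrite lee_pdivlMr.
have kn : (1 <= k <= k + n - 1)%N by rewrite k1/= /n addnS subn1 leq_addr.
have AG : A%:E <= Gstat pi Z (k + n - 1)%N w.
  apply: le_trans (Gstat_ge w kn).
  apply: (@le_trans _ _ ((pi k)%:E * (expR ((q - eps) * n%:R))%:E)).
    rewrite -EFinM lee_fin -[leLHS]lnK ?posrE// -[X in (_ <= X * _)%R]lnK ?posrE//.
    rewrite -expRD ler_expR.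
    have : (L * (q - eps) <= (q - eps) * n%:R)%R.
      by rewrite mulrC ler_pM2l//; lra.
    rewrite /L mulrDl !divfK ?gt_eqF//.
    have := ler_norm (- ln (pi k)); rewrite normrN; lra.
  by rewrite lee_pmul2l// ?lte_fin// -[(expR _)%:E]/(expeR _%:E) lee_expeR.
have [|j tj jn] := @first_time_le
    [pred n | (1 <= n)%N && (A%:E <= Gstat pi Z n w)] (k + n - 1)%N.
  by case/andP: kn => _ kn; rewrite /= AG (leq_trans k1 kn).
rewrite (tj : tauA pi Z A w = Some j)/= -EFinB -EFinD lee_fin lerBlDr.
apply: (@le_trans _ _ (k + n - 1)%N%:R); first by rewrite ler_nat.
rewrite /n addnS subn1/= natrD addrC lerD2r.
by rewrite truncn_le addr_ge0.
Qed.

Variables m r : R.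
Hypotheses (m_gt0 : (0 < m)%R) (m_le_r : (m <= r)%R).
Hypothesis cond_b : forall eps : R, (0 < eps)%R ->
  \sum_(1 <= k <oo)
    (pi k)%:E * \int[P k]_w (last_entry Z q eps k w `^ r) < +oo.
Hypothesis cond_c :
  \sum_(1 <= k <oo) ((`|ln (pi k)| `^ m)%R * pi k)%:E < +oo.

Lemma delay_integral_le (eps delta : R) :
  (0 < eps)%R -> (eps < q)%R -> (0 < delta)%R ->
  exists C : R, forall A, (1 <= A)%R ->
    \int[Ppi]_(z in [set z | z.1%:R%:E <= ext_time (R := R) (tauA pi Z A z.2)])
       (ext_time (R := R) (tauA pi Z A z.2) - z.1%:R%:E) `^ m <=
    ((1 + delta) `^ m * (ln A / (q - eps)) `^ m + C)%:E.
Proof.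
move=> eps0 epsq d0; have qe : (0 < q - eps)%R by rewrite subr_gt0.
pose I k := \int[P k]_w (last_entry Z q eps k w `^ r).
have I0 k : 0 <= I k by apply: integral_ge0 => w _; exact: poweR_ge0.
have pi0 k : (1 <= k)%N -> (0 <= pi k)%R by exact: (prior_ge0 prior).
have bI0 k : (1 <= k)%N -> 0 <= (pi k)%:E * I k.
  by move=> k1; rewrite mule_ge0// lee_fin pi0.
have lnpi0 k : (1 <= k)%N -> 0 <= ((`|ln (pi k)| `^ m)%R * pi k)%:E.
  by move=> k1; rewrite lee_fin mulr_ge0 ?powR_ge0// pi0.
have := cond_b eps0; set SB := (X in X < _) => SBoo.
have := cond_c; set SC := (X in X < _) => SCoo.
have SB0 : 0 <= SB by apply: nneseries_ge0 => k k1 _; exact: bI0.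
have SC0 : 0 <= SC by apply: nneseries_ge0 => k k1 _; exact: lnpi0.
have finSB : SB \is a fin_num by rewrite ge0_fin_numE.
have finSC : SC \is a fin_num by rewrite ge0_fin_numE.
pose K := (((1 + delta^-1) * 2) `^ m)%R.
have K0 : (0 <= K)%R by exact: powR_ge0.
pose K' := (K * (q - eps)^-1 `^ m)%R.
have K'0 : (0 <= K')%R by rewrite mulr_ge0// powR_ge0.
(* Independent of A: the three summands come from the constant 1, the last entry time and the prior
   term in [poweR_delay_bound]; [K'] includes the factor left by dividing |ln pi_k| by q - eps. *)
exists (K + K * fine SB + K' * fine SC)%R => A A1.
set u := ((1 + delta) `^ m * (ln A / (q - eps)) `^ m)%R.
have u0 : (0 <= u)%R by rewrite mulr_ge0// powR_ge0.
have st : stopping_time X (tauA pi Z A) by exact: (tauA_stopping model).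
set S0 := [set z | _]; set F := (fun z => _ `^ m).
have mS0 : measurable S0.
  rewrite (_ : S0 = [set z : nat * T | (z.1 + 0)%:R%:E <= ext_time (R := R) (tauA pi Z A z.2)]).
    exact: (measurable_detected mX st).
  by apply/seteqP; split => z /=; rewrite /S0/= addn0.
have mF : measurable_fun setT (F \_ S0).
  apply: (proj1 (measurable_restrictT F mS0)); apply: measurable_funTS.
  exact: (measurable_delay mX st).
have F0 z : 0 <= (F \_ S0) z by rewrite patchE; case: ifP => // _; exact: poweR_ge0.
rewrite integral_mkcond (integral_joint prior joint)//.
have termle k : (1 <= k)%N -> (pi k)%:E * \int[P k]_w (F \_ S0) (k, w) <=
    (u + K)%:E * (pi k)%:E + (K%:E * ((pi k)%:E * I k) +
      K'%:E * ((`|ln (pi k)| `^ m)%R * pi k)%:E).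
  (* At pi_k = 0 the pathwise delay bound fails to apply, but both sides vanish. *)
  move=> k1; have [pk0|pk0] := eqVneq (pi k) 0%R.
    rewrite pk0 !mul0e !mule0 mulr0 mule0 !adde0.
    by [].
  have {}pk0 : (0 < pi k)%R by rewrite lt0r pk0 pi0.
  set b := (`|ln (pi k)| / (q - eps))%R.
  have b0 : (0 <= b)%R by rewrite divr_ge0// ltW.
  have bm : (b `^ m = `|ln (pi k)| `^ m * (q - eps)^-1 `^ m)%R.
    by rewrite powRM// invr_ge0 ltW.
  have mT : measurable_fun setT (fun w => last_entry Z q eps k w `^ r).
    apply: (measurableT_comp (measurable_poweR r)); exact: measurable_last_entry.
  have intle : \int[P k]_w (F \_ S0) (k, w) <=
      u%:E + K%:E * (1 + I k + (b `^ m)%:E).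
    apply: (@le_trans _ _ (\int[P k]_w
        (u%:E + K%:E * (1 + last_entry Z q eps k w `^ r + (b `^ m)%:E)))).
      apply: ge0_le_integral => //.
      - exact: measurableT_comp mF (measurable_pair1 k).
      - apply: emeasurable_funD => //; apply: measurable_funeM.
        by apply: emeasurable_funD => //; exact: emeasurable_funD.
      - move=> w _; rewrite patchE; case: ifPn => [|_]; last first.
          rewrite adde_ge0 ?lee_fin// mule_ge0 ?lee_fin// adde_ge0 ?lee_fin ?powR_ge0//.
          by rewrite adde_ge0// poweR_ge0.
        rewrite inE /S0/= /F/= => kw.
        have a0 : (0 <= ln A / (q - eps))%R by rewrite divr_ge0 ?ln_ge0// ltW.
        apply: le_trans (poweR_delay_bound m_gt0 m_le_r d0 a0 b0
          (last_entry_ge0 eps k w)).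
        have dl := tauA_delay_le w pk0 k1 A1 eps0 epsq.
        have dl0 : 0 <= ext_time (R := R) (tauA pi Z A w) - k%:R%:E.
          by rewrite sube_ge0//.
        apply: gt0_ler_poweR => //; rewrite ?in_itv/= ?leey ?andbT//.
          exact: ltW.
        exact: le_trans dl.
    rewrite ge0_integralD//; last 2 first.
    - move=> w _; rewrite mule_ge0 ?lee_fin// adde_ge0 ?lee_fin ?powR_ge0//.
      by rewrite adde_ge0// poweR_ge0.
    - apply: measurable_funeM.
      by apply: emeasurable_funD => //; exact: emeasurable_funD.
    rewrite integral_cst// [X in _ * X](probability_setT (P k)) mule1 leeD2l//.
    rewrite ge0_integralZl_EFin//; last 2 first.
    - move=> w _; rewrite adde_ge0 ?lee_fin ?powR_ge0//.
      by rewrite adde_ge0// poweR_ge0.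
    - by apply: emeasurable_funD => //; exact: emeasurable_funD.
    apply: lee_wpmul2l; first by rewrite lee_fin.
    rewrite ge0_integralD//; last 3 first.
    - by move=> w _; rewrite adde_ge0// poweR_ge0.
    - exact: emeasurable_funD.
    - by move=> w _; rewrite lee_fin powR_ge0.
    rewrite ge0_integralD//; last by move=> w _; exact: poweR_ge0.
    rewrite !integral_cst// [X in _ * X + _ + _](probability_setT (P k)).
    by rewrite [X in _ + _ * X](probability_setT (P k)) !mule1.
  apply: le_trans (lee_wpmul2l _ intle) _; first by rewrite lee_fin ltW.
  rewrite le_eqVlt; apply/orP; left; apply/eqP.
  have K_gt0 : (0 < K)%R by rewrite powR_gt0// mulr_gt0// addr_gt0// invr_gt0.
  (* An infinite moment is treated directly: [pi k] and [K] are positive, so both sides are then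
     +oo. *)
  case: (I k) (I0 k) => [i||//] _.
    suff h : (pi k * (u + K * (1 + i + b `^ m)) = (u + K) * pi k + (K * (pi k * i) +
        K' * (`|ln (pi k)| `^ m * pi k)))%R by exact: (congr1 EFin h).
    by rewrite bm /K'; ring.
  by rewrite addey// addye// !gt0_muley ?lte_fin// addye// [in RHS]addey.
rewrite nneseries_shift1; last first.
  by move=> k k1; rewrite mule_ge0 ?lee_fin ?pi0//; exact: integral_ge0.
apply: (@le_trans _ _ (\sum_(k <oo) ((u + K)%:E * (pi k.+1)%:E +
  (K%:E * ((pi k.+1)%:E * I k.+1) +
      K'%:E * ((`|ln (pi k.+1)| `^ m)%R * pi k.+1)%:E)))).
  apply: lee_nneseries => k _ /=; last exact: termle.
  by rewrite mule_ge0 ?lee_fin ?pi0//; exact: integral_ge0.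
have uK0 : (0 <= u + K)%R by exact: addr_ge0.
rewrite nneseriesD; last 2 first.
- by move=> k _ _; rewrite mule_ge0// lee_fin// pi0.
- move=> k _ _; rewrite adde_ge0// mule_ge0 ?lee_fin//; first exact: bI0.
  exact: (lnpi0 k.+1).
rewrite nneseriesD; last 2 first.
- by move=> k _ _; rewrite mule_ge0 ?lee_fin//; exact: bI0.
- by move=> k _ _; rewrite mule_ge0 ?lee_fin//; exact: (lnpi0 k.+1).
rewrite !nneseriesZl; last 3 first.
- by move=> k _; exact: (lnpi0 k.+1).
- by move=> k _; exact: bI0.
- by move=> k _; rewrite lee_fin pi0.
rewrite -(nneseries_shift1 (u := fun k => (pi k)%:E)); last first.
  by move=> k k1; rewrite lee_fin pi0.
rewrite -(nneseries_shift1 (u := fun k => (pi k)%:E * I k))//.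
rewrite -(nneseries_shift1 (u := fun k => ((`|ln (pi k)| `^ m)%R * pi k)%:E))//.
rewrite (prior_sum1 prior) mule1 -/SB -/SC -(fineK finSB) -(fineK finSC).
rewrite -!EFinM -!EFinD lee_fin.
by rewrite !addrA.
Qed.

Lemma delay_moment_tauA_upper (eta : R) : (0 < eta)%R -> (eta < 1)%R ->
  (forall eta, (0 < eta)%R -> \forall A \near +oo%R, (1 - eta)%:E <=
     Ppi [set z | z.1%:R%:E <= ext_time (R := R) (tauA pi Z A z.2)]) ->
  \forall A \near +oo%R,
    delay_moment Ppi m (tauA pi Z A) <= ((1 + eta) * (ln A / q) `^ m)%:E.
Proof.
move=> eta0 eta1 hprob; pose h := (eta / 6)%R.
have h0 : (0 < h)%R by rewrite divr_gt0.
(* The factor 1 + h is shared equally between the split and the drift: with 1 + delta = u and q -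
   eps = q / u, each contributes u^m = v, and v^2 = 1 + h. *)
pose v := Num.sqrt (1 + h)%R.
have vv : (v * v = 1 + h)%R by rewrite -expr2 sqr_sqrtr// addr_ge0// ltW.
have v0 : (0 <= v)%R by exact: sqrtr_ge0.
have v1 : (1 < v)%R by nra.
pose u := (v `^ m^-1)%R.
have u0 : (0 < u)%R by rewrite powR_gt0//; lra.
have um : (u `^ m = v)%R by rewrite /u -powRrM mulVf ?gt_eqF// powRr1.
have u1 : (1 < u)%R.
  rewrite ltNge; apply/negP => u1.
  have := ge0_ler_powR (ltW m_gt0) (x := u) (y := 1%R).
  by rewrite !nnegrE powR1 um => /(_ (ltW u0) ler01 u1); lra.
have qu : (q / u < q)%R by rewrite ltr_pdivrMr// ltr_pMr.
have qu0 : (0 < q / u)%R by rewrite divr_gt0.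
have [|||C hC] := @delay_integral_le (q - q / u) (u - 1).
- by rewrite subr_gt0.
- by lra.
- by rewrite subr_gt0.
(* Chosen so that C <= h (ln A / q)^m as soon as ln A / q >= M. *)
pose M := ((`|C| / h) `^ m^-1)%R.
have M0 : (0 <= M)%R by exact: powR_ge0.
have Mm : (M `^ m = `|C| / h)%R.
  by rewrite /M -powRrM mulVf ?gt_eqF// powRr1// divr_ge0// ltW.
near=> A.
have A1 : (1 <= A)%R by near: A; exact: nbhs_pinfty_ge.
have MA : (M * q <= ln A)%R by near: A; exact: near_ln_ge.
have PQ : (1 - h)%:E <=
    Ppi [set z | z.1%:R%:E <= ext_time (R := R) (tauA pi Z A z.2)].
  by near: A; exact: hprob.
have My : (M <= ln A / q)%R by rewrite ler_pdivlMr.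
have {hC} := hC A A1.
rewrite (_ : q - (q - q / u) = q / u)%R; last by rewrite subKr.
rewrite (_ : 1 + (u - 1) = u)%R; last by rewrite addrC subrK.
rewrite (_ : ln A / (q / u) = u * (ln A / q))%R; last first.
  by field; rewrite !gt_eqF.
set y := (ln A / q)%R in My *.
have y0 : (0 <= y)%R by exact: le_trans My.
rewrite (powRM _ (ltW u0) y0) um mulrA vv => hI.
have Cy : (C <= h * y `^ m)%R.
  apply: le_trans (ler_norm C) _.
  rewrite mulrC -ler_pdivrMr// -Mm; apply: ge0_ler_powR => //; first exact: ltW.
rewrite /delay_moment /cond_expectation.
set Q := Ppi _ in PQ *.
have finQ : Q \is a fin_num.
  rewrite ge0_fin_numE ?measure_ge0//; apply: le_lt_trans (ltry 1).
  apply: probability_le1.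
  rewrite (_ : [set z | _] = [set z : nat * T |
      (z.1 + 0)%:R%:E <= ext_time (R := R) (tauA pi Z A z.2)]).
    exact: (measurable_detected mX (@tauA_stopping _ _ _ _ _ _ _ _ _ _ _ model pi A)).
  by apply/seteqP; split => z /=; rewrite addn0.
have Qh : (1 - h <= fine Q)%R by rewrite -lee_fin fineK.
have h6 : (h < 6^-1)%R by rewrite /h ltr_pdivrMr// mulVf// gt_eqF.
have Q0 : (0 < fine Q)%R.
  by apply: lt_le_trans Qh; rewrite subr_gt0 (lt_trans h6)// invf_lt1// ltr1n.
rewrite -(fineK finQ) inver gt_eqF// lee_pdivrMr//.
apply: (le_trans hI); rewrite -EFinM lee_fin.
have -> : eta = (6 * h)%R by rewrite /h; field.
exact: (quotient_margin h0 h6 (powR_ge0 _ _) Cy Qh).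
Unshelve. all: by end_near. Qed.
End upper_bound.

(** * From two-sided bounds to asymptotic equivalence *)

(** The bounds for eta = 1/2 already force [g] to be finite eventually, which reduces extended-real
    convergence to convergence of real numbers. *)
Lemma cvg1_near {R : realType} {I : Type} (F : set_system I) {FF : Filter F}
    (g : I -> \bar R) :
  (forall eta : R, (0 < eta)%R -> (eta < 1)%R ->
    \forall x \near F, (1 - eta)%:E <= g x /\ g x <= (1 + eta)%:E) ->
  g x @[x --> F] --> (1 : \bar R).
Proof.
move=> hg; apply/fine_cvgP; split.
  have h2 : (2^-1 < 1 :> R)%R by rewrite invf_lt1// ltr1n.
  have h0 : (0 < 2^-1 :> R)%R by rewrite invr_gt0.
  apply: filterS (hg _ h0 h2) => x [lo hi]; rewrite fin_numE -ltNye -ltey.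
  by rewrite (lt_le_trans _ lo) ?ltNyr//= (le_lt_trans hi) ?ltry.
apply/cvgrPdist_le => e e0.
pose eta := Num.min e (2^-1)%R.
have h2 : (2^-1 < 1 :> R)%R by rewrite invf_lt1// ltr1n.
have eta0 : (0 < eta)%R by rewrite lt_min e0 invr_gt0/=.
have eta1 : (eta < 1)%R by rewrite gt_min h2 orbT.
have etae : (eta <= e)%R by rewrite ge_min lexx.
apply: filterS (hg _ eta0 eta1) => x [lo hi] /=.
have : g x \is a fin_num.
  rewrite fin_numE -ltNye -ltey.
  by rewrite (lt_le_trans _ lo) ?ltNyr//= (le_lt_trans hi) ?ltry.
case: (g x) lo hi => // y; rewrite !lee_fin/= => lo hi _.
by rewrite ler_norml; apply/andP; split; lra.
Qed.

Lemma asymp_equiv_near {R : realType} {I : Type} (F : set_system I)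
    {FF : Filter F} (a : I -> \bar R) (b : I -> R) :
  (forall eta : R, (0 < eta)%R -> (eta < 1)%R ->
    \forall x \near F, [/\ (0 < b x)%R, ((1 - eta) * b x)%:E <= a x &
                           a x <= ((1 + eta) * b x)%:E]) ->
  asymp_equiv F a (fun x => (b x)%:E).
Proof.
move=> h; apply: cvg1_near => eta eta0 eta1.
apply: filterS (h _ eta0 eta1) => x [b0 lo hi].
by rewrite inver gt_eqF// lee_pdivlMr// lee_pdivrMr// -!EFinM.
Qed.

Lemma near_inv_right0 {R : realType} (Q : R -> Prop) :
  (\forall A \near +oo%R, Q A) -> \forall a \near (0:R)^'+, Q a^-1%R.
Proof.
move=> hQ; suff : (x^-1)%R @[x --> (0:R)^'+] --> +oo%R by exact.
apply/cvgrVy; last exact: cvg_at_right_filter cvg_id.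
exact: nbhs_right_gt.
Qed.
Theorem theorem4 (R : realType) (d e : measure_display)
  (T : measurableType d) (E : measurableType e)
  (mu : {sigma_finite_measure set E -> \bar R})
  (X : nat -> T -> E)
  (f0 : forall i : nat, i.-1.-tuple E -> E -> R)
  (f1 : forall k i : nat, i.-1.-tuple E -> E -> R)
  (Pinf : probability T R) (P : nat -> probability T R)
  (pi : nat -> R) (Ppi : probability (nat * T)%type R)
  (Z := llr X f0 f1)
  (D := fun (m : R) (tau : T -> option nat) => delay_moment Ppi m tau)
  (model : changepoint_model mu X f0 f1 Pinf P)
  (prior : is_prior pi) (joint : is_joint_law pi P Ppi)
  (q r : R) (q_gt0 : (0 < q)%R) (r_ge1 : (1 <= r)%R)
  (cond_a : forall (eps : R) (k : nat), (0 < eps)%R -> (1 <= k)%N ->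
     P k [set w | (M%:R^-1)%:E * \big[maxe/-oo]_(1 <= n < M.+1) Z k (k + n - 1)%N w
                  >= ((1 + eps) * q)%:E] @[M --> \oo] --> (0 : \bar R))
  (cond_b : forall eps : R, (0 < eps)%R ->
     \sum_(1 <= k <oo)
        (pi k)%:E * \int[P k]_w (last_entry Z q eps k w `^ r) < +oo)
  (cond_c : forall m : R, (0 < m)%R -> (m <= r)%R ->
     \sum_(1 <= k <oo) ((`|ln (pi k)| `^ m)%R * pi k)%:E < +oo) :
  (forall m : R, (0 < m)%R -> (m <= r)%R ->
     asymp_equiv (pinfty_nbhs R)
       (fun A => D m (tauA pi Z A)) (fun A => ((ln A / q) `^ m)%R%:E)) /\
  (forall alpha : R, (0 < alpha)%R -> (alpha < 1)%R ->
     Delta_inf X Pinf alpha (tauA pi Z alpha^-1)) /\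
  (forall m : R, (0 < m)%R -> (m <= r)%R ->
     asymp_equiv (0%R^'+)
       (fun alpha => ereal_inf [set D m tau | tau in Delta_inf X Pinf alpha])
       (fun alpha => D m (tauA pi Z alpha^-1)) /\
     asymp_equiv (0%R^'+)
       (fun alpha => D m (tauA pi Z alpha^-1))
       (fun alpha => ((`|ln alpha| / q) `^ m)%R%:E)).
Proof.
have Dtau A : (0 < A)%R -> Delta_inf X Pinf A^-1 (tauA pi Z A).
  move=> A0; rewrite -[A in tauA _ _ A]invrK.
  by apply: (tauA_Delta_inf model prior joint); rewrite invr_gt0.
have lower m eta (m0 : (0 < m)%R) := delay_moment_lower model prior joint q_gt0
  cond_a (m := m) (eta := eta) m0.
have upper m eta : (0 < m)%R -> (m <= r)%R -> (0 < eta)%R -> (eta < 1)%R ->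
    \forall A \near +oo%R, D m (tauA pi Z A) <= ((1 + eta) * (ln A / q) `^ m)%:E.
  move=> m0 mr eta0 eta1.
  apply: (delay_moment_tauA_upper model prior joint q_gt0 m0 mr) => //.
    exact: cond_c.
  move=> eta' eta'0.
  exact: (detection_probability_near model prior joint q_gt0 cond_a).
have both m eta : (0 < m)%R -> (m <= r)%R -> (0 < eta)%R -> (eta < 1)%R ->
    \forall A \near +oo%R, [/\ (0 < (ln A / q) `^ m)%R,
      forall tau, Delta_inf X Pinf A^-1 tau ->
        ((1 - eta) * (ln A / q) `^ m)%:E <= D m tau &
      D m (tauA pi Z A) <= ((1 + eta) * (ln A / q) `^ m)%:E].
  move=> m0 mr eta0 eta1; near=> A; split.
  - have : (1 <= ln A)%R by near: A; exact: near_ln_ge.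
    by move=> A1; rewrite powR_gt0// divr_gt0//; lra.
  - by near: A; exact: lower.
  - by near: A; exact: upper.
have both' m eta : (0 < m)%R -> (m <= r)%R -> (0 < eta)%R -> (eta < 1)%R ->
    \forall alpha \near 0^'+, [/\ (0 < alpha)%R, (0 < (`|ln alpha| / q) `^ m)%R,
      forall tau, Delta_inf X Pinf alpha tau ->
        ((1 - eta) * (`|ln alpha| / q) `^ m)%:E <= D m tau &
      D m (tauA pi Z alpha^-1) <= ((1 + eta) * (`|ln alpha| / q) `^ m)%:E].
  move=> m0 mr eta0 eta1.
  have hboth := near_inv_right0 (both m eta m0 mr eta0 eta1); near=> alpha.
  have a0 : (0 < alpha)%R by near: alpha; exact: nbhs_right_gt.
  have a1 : (alpha < 1)%R by near: alpha; exact: nbhs_right_lt.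
  have -> : `|ln alpha|%R = ln alpha^-1.
    by rewrite lnV ?posrE// ltr0_norm// ln_lt0// a0.
  have [] : [/\ (0 < (ln alpha^-1 / q) `^ m)%R,
      forall tau, Delta_inf X Pinf alpha^-1^-1 tau ->
        ((1 - eta) * (ln alpha^-1 / q) `^ m)%:E <= D m tau &
      D m (tauA pi Z alpha^-1) <= ((1 + eta) * (ln alpha^-1 / q) `^ m)%:E].
    by near: alpha; exact: hboth.
  by rewrite invrK; split.
split; [|split].
- move=> m m0 mr; apply: asymp_equiv_near => eta eta0 eta1; near=> A.
  have A0 : (0 < A)%R by near: A; exact: nbhs_pinfty_gt.
  have [L0 lo hi] : [/\ (0 < (ln A / q) `^ m)%R,
      forall tau, Delta_inf X Pinf A^-1 tau ->
        ((1 - eta) * (ln A / q) `^ m)%:E <= D m tau &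
      D m (tauA pi Z A) <= ((1 + eta) * (ln A / q) `^ m)%:E].
    by near: A; exact: both.
  by split => //; apply: lo; exact: Dtau.
- move=> alpha alpha0 _; exact: (tauA_Delta_inf model prior joint).
move=> m m0 mr; split.
- apply: cvg1_near => eta eta0 eta1.
  (* Half of eta is enough: the infimum is at least (1 - eta/2) L, the moment of [tauA] at most (1 +
     eta/2) L, and (1 - eta)(1 + eta/2) <= 1 - eta/2. The other direction holds because [tauA] is
     itself a competitor. *)
  have e0 : (0 < eta / 2)%R by rewrite divr_gt0.
  have e1 : (eta / 2 < 1)%R by lra.
  apply: filterS (both' m _ m0 mr e0 e1) => alpha [a0 L0 lo hi].
  move: (_ `^ m)%R L0 lo hi => L L0 lo hi.
  have Dal := tauA_Delta_inf model prior joint a0.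
  have := lo _ Dal; move: hi.
  case dE : (D m (tauA pi Z alpha^-1)) => [c||//]; rewrite ?lee_fin// => hi' lo'.
  have c0 : (0 < c)%R by nra.
  rewrite inver gt_eqF// lee_pdivlMr// lee_pdivrMr//; split.
    apply: le_ereal_inf_tmp => _ [tau Dt <-].
    apply: le_trans (lo _ Dt); rewrite -EFinM lee_fin.
    by nra.
  apply: (@le_trans _ _ c%:E); last by rewrite -EFinM lee_fin; nra.
  by rewrite -dE; apply: ereal_inf_lbound; exists (tauA pi Z alpha^-1).
- apply: asymp_equiv_near => eta eta0 eta1.
  apply: filterS (both' m _ m0 mr eta0 eta1) => alpha [a0 L0 lo hi].
  by split => //; apply: lo; exact: (tauA_Delta_inf model prior joint).
Unshelve. all: by end_near. Qed.
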